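(* For the Gaussian state-dependent multiaccess channel described in the context, the capacity region $\mathcal C_G$ is contained in the union, over all $\rho_{12}\in[0,1]$ and $\rho_{2s}\in[-1,0]$ with $\rho_{12}^2+\rho_{2s}^2\le1$, of the set of rate pairs $(R_c,R_1)$ satisfying $$R_1\le\tfrac12\log\Big(1+\frac{P_1(1-\rho_{12}^2-\rho_{2s}^2)}{N(1-\rho_{2s}^2)}\Big),$$ $$R_c+R_1\le\tfrac12\log\Big(1+\frac{(\sqrt{P_1}+\rho_{12}\sqrt{P_2})^2}{P_2(1-\rho_{12}^2-\rho_{2s}^2)+(\sqrt Q+\rho_{2s}\sqrt{P_2})^2+N}\Big)+\tfrac12\log\Big(1+\frac{P_2(1-\rho_{12}^2-\rho_{2s}^2)}{N}\Big),$$ where, when $\rho_{2s}=-1$ (so $\rho_{12}=0$), the ratio $\frac{1-\rho_{12}^2-\rho_{2s}^2}{1-\rho_{2s}^2}$ is interpreted as $1$.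
   Context: Gaussian model: at each time $i$, $Y_i=X_{1,i}+X_{2,i}+S_i+Z_i$, where $S_i\sim\mathcal N(0,Q)$ (state) and $Z_i\sim\mathcal N(0,N)$ (noise), all $S_i,Z_i$ mutually independent across time and of each other, and independent of the messages; $Q,N>0$. Two independent uniformly distributed messages: a common message $W_c$ of rate $R_c$ and an individual message $W_1$ of rate $R_1$. The uninformed encoder maps $(W_c,W_1)$ to $X_1^n$; the informed encoder knows the entire state sequence $S^n$ non-causally and maps $(S^n,W_c)$ to $X_2^n$; the decoder, which does not know the state, maps $Y^n$ to an estimate of $(W_c,W_1)$. Power constraints: $\sum_{i=1}^n X_{1,i}^2\le nP_1$ and $\sum_{i=1}^n X_{2,i}^2\le nP_2$. A rate pair is achievable if there are codes satisfying these constraints whose probability of decoding error $\Pr[\psi^n(Y^n)\neq (W_c,W_1)]$ tends to $0$ as $n\to\infty$; $\mathcal C_G$ is the closure of the set of achievable pairs. *)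

(* Defs.v *)
From HB Require Import structures.
From mathcomp Require Import all_boot all_order all_algebra.
From mathcomp Require Import all_classical all_reals all_analysis.

Set Implicit Arguments.
Unset Strict Implicit.
Unset Printing Implicit Defensive.

Import Order.TTheory GRing.Theory Num.Theory.
Import numFieldNormedType.Exports.

Local Open Scope classical_set_scope.
Local Open Scope ring_scope.

Section GaussianMAC.
Variable R : realType.

Definition vcons n (x : R) (v : 'I_n -> R) : 'I_n.+1 -> R :=
  fun i => if unlift ord0 i is Some j then v j else x.

Definition boxes n : set (set ('I_n -> R)) :=
  [set B | exists F : 'I_n -> set R,
      (forall i, measurable (F i)) /\ B = [set x | forall i, F i (x i)]].

Definition borel_n n (A : set ('I_n -> R)) : Prop :=
  smallest (sigma_algebra setT) (@boxes n) A.

Definition borel_fun n m (f : ('I_n -> R) -> ('I_m -> R)) : Prop :=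
  forall B, @borel_n m B -> @borel_n n (f @^-1` B).

(* Integral over R^n w.r.t. Lebesgue measure (iterated; used only for
   nonnegative Borel integrands, where it coincides with the product
   integral by Tonelli). *)
Fixpoint iint (n : nat) : (('I_n -> R) -> \bar R) -> \bar R :=
  match n return (('I_n -> R) -> \bar R) -> \bar R with
  | 0 => fun F => F (fun _ => 0)
  | m.+1 => fun F =>
      (\int[@lebesgue_measure R]_x iint (fun v => F (vcons x v)))%E
  end.

Definition gauss_n n (var : R) (v : 'I_n -> R) : R :=
  \prod_(i < n) normal_pdf 0 (Num.sqrt var) (v i).

Record code (n Mc M1 : nat) := Code {
  enc1 : 'I_Mc -> 'I_M1 -> 'I_n -> R;
  enc2 : 'I_Mc -> ('I_n -> R) -> 'I_n -> R;        (* informed encoder: (W_c, S^n) *)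
  dec  : ('I_n -> R) -> 'I_Mc * 'I_M1
}.

Definition code_ok n Mc M1 (P1 P2 : R) (C : code n Mc M1) : Prop :=
  (forall wc w1, \sum_(i < n) (enc1 C wc w1 i) ^+ 2 <= n%:R * P1) /\
  (forall wc s, \sum_(i < n) (enc2 C wc s i) ^+ 2 <= n%:R * P2) /\
  (forall wc, borel_fun (enc2 C wc)) /\
  (forall w, borel_n [set y | dec C y = w]).

(* Pr[ dec(Y^n) <> (wc,w1) ] given messages (wc,w1), S ~ N(0,Q I), Z ~ N(0,N I) *)
Definition err_msg n Mc M1 (Q N : R) (C : code n Mc M1) wc w1 : \bar R :=
  iint (fun s : 'I_n -> R => ((gauss_n Q s)%:E *
    iint (fun z : 'I_n -> R => ((gauss_n N z)%:E *
      ((dec C (fun i => enc1 C wc w1 i + enc2 C wc s i + s i + z i)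
          != (wc, w1))%:R)%:E)%E))%E).

Definition err_prob n Mc M1 (Q N : R) (C : code n Mc M1) : \bar R :=
  ((\sum_(wc < Mc) \sum_(w1 < M1) err_msg Q N C wc w1) *
     ((Mc * M1)%:R^-1)%:E)%E.

(* Achievable rate pairs (rates in nats: at least exp(n R) messages). *)
Definition achievable (P1 P2 Q N : R) (Rc R1 : R) : Prop :=
  exists (Mc M1 : nat -> nat) (C : forall n, code n (Mc n) (M1 n)),
    (forall n, (0 < Mc n)%N /\ (0 < M1 n)%N) /\
    (forall n, expR (n%:R * Rc) <= (Mc n)%:R /\
               expR (n%:R * R1) <= (M1 n)%:R) /\
    (forall n, code_ok P1 P2 (C n)) /\
    (err_prob Q N (C n) @[n --> \oo] --> 0%E).

Definition capacity_region (P1 P2 Q N : R) : set (R * R) :=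
  closure [set p | achievable P1 P2 Q N p.1 p.2].

Definition ratio12 (r12 r2s : R) : R :=
  if r2s == -1 then 1 else (1 - r12 ^+ 2 - r2s ^+ 2) / (1 - r2s ^+ 2).

Definition outer_bound (P1 P2 Q N : R) : set (R * R) :=
  [set p | exists r12 r2s : R,
     [/\ 0 <= r12 <= 1, -1 <= r2s <= 0, r12 ^+ 2 + r2s ^+ 2 <= 1,
       p.2 <= 2^-1 * ln (1 + P1 * ratio12 r12 r2s / N) &
       p.1 + p.2 <=
         2^-1 * ln (1 + (Num.sqrt P1 + r12 * Num.sqrt P2) ^+ 2 /
                      (P2 * (1 - r12 ^+ 2 - r2s ^+ 2)
                       + (Num.sqrt Q + r2s * Num.sqrt P2) ^+ 2 + N))
       + 2^-1 * ln (1 + P2 * (1 - r12 ^+ 2 - r2s ^+ 2) / N)]].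

End GaussianMAC.

(* Main.v *)
Require Import Defs.
From HB Require Import structures.
From mathcomp Require Import all_boot all_order all_algebra.
From mathcomp Require Import all_classical all_reals all_analysis.
From mathcomp Require Import measurable_realfun ring lra.

(** Fix a code and let P be the joint law of (W, S, Y).  For any reference law
    P' under which the message to be decoded is independent of Y, comparing P
    and P' on the event of correct decoding gives
    (1 - error) log M <= E_P log (dP/dP') + 1,
    so no entropies are needed: P' may be chosen Gaussian with explicit
    density, and E_P log (dP/dP') is then an affine function of second moments.

    For R_1, P' replaces the law of Y given (W_c, S) by a Gaussian centred at
    the conditional mean of X_1 given W_c.  For R_c + R_1, P' is a centred
    Gaussian law of Y followed by a Gaussian law of S centred at its linear
    estimate from (X_1, Y).  The second moments of the code, constrained by
    X_2 being a function of (W_c, S), are then matched with (rho_12, rho_2s);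
    the limit in the block length uses compactness of the parameter set. *)

Set Implicit Arguments.
Unset Strict Implicit.
Unset Printing Implicit Defensive.

Import Order.TTheory GRing.Theory Num.Theory.
Import numFieldNormedType.Exports.
Import HBNNSimple.
Local Open Scope classical_set_scope.
Local Open Scope ring_scope.

(** The reference laws come from two information quantities. For [R_1] it is I(W_1; Y | W_c, S). For
    the sum it is I(W; Y) = h(Y) - h(Z) - h(S) + h(S | W, Y), whose two positive entropies are
    bounded by Gaussian ones of free variances [sig] and [tau]; this is the origin of
    [ln (sig * tau / (N * Q))]. The delicate point is that one rho_12 must serve both bounds: the
    first limits it by the share of the power of X_1 that W_c determines, the second uses it as the
    correlation of X_1 and X_2. Since X_2 sees only W_c and S, that correlation passes through the
    conditional mean of X_1, and positivity of the Gram matrix of this mean, X_2 and S links the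
    two. The variances and coefficients of the reference laws are the same for all times and
    messages, so second moments are averaged over both before any logarithm is taken. One parameter
    pair is read off from these averages, and convexity of the union never enters. *)

Lemma ge0_integral_density d (T : measurableType d) (R : realType)
    (mu nu : {measure set T -> \bar R}) (g : T -> R) :
  measurable_fun setT g -> (forall x, 0 <= g x) ->
  (forall A, measurable A -> nu A = \int[mu]_(x in A) (g x)%:E)%E ->
  forall f : T -> \bar R, measurable_fun setT f -> (forall x, 0 <= f x)%E ->
  (\int[nu]_x f x = \int[mu]_x ((g x)%:E * f x))%E.
Proof.
move=> mg g0 nuE f mf f0.
have sfunE (h : {nnsfun T >-> R}) :
    (\int[nu]_x (h x)%:E = \int[mu]_x ((g x)%:E * (h x)%:E))%E.
  under [LHS]eq_integral do rewrite fimfunE -fsumEFin//.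
  rewrite [LHS]ge0_integral_fsum//; last 2 first.
    - by move=> r; exact/measurable_EFinP/measurableT_comp.
    - by move=> n x _; rewrite EFinM nnfun_muleindic_ge0.
  under [RHS]eq_integral.
    move=> x _; rewrite fimfunE -fsumEFin// ge0_mule_fsumr; last first.
      by move=> r; rewrite EFinM nnfun_muleindic_ge0.
    over.
  rewrite [RHS]ge0_integral_fsum//; last 2 first.
    - move=> r; apply: emeasurable_funM => //; first exact/measurable_EFinP.
      exact/measurable_EFinP/measurableT_comp.
    - by move=> n x _; rewrite mule_ge0 ?lee_fin// -lee_fin EFinM nnfun_muleindic_ge0.
  apply: eq_fsbigr => r rh; rewrite integralZl_indic_nnsfun//=.
  rewrite integral_indic// setIT nuE//.
  under [RHS]eq_integral do rewrite EFinM muleCA.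
  have r0 : (0 <= r)%R by move: rh; rewrite inE => -[x _ <-].
  rewrite [RHS]ge0_integralZl//; last 2 first.
    - apply: emeasurable_funM; first exact/measurable_EFinP.
      exact/measurable_EFinP/measurable_indic.
    - by move=> x _; rewrite mule_ge0 ?lee_fin.
  congr (_ * _)%E; rewrite integral_mkcond; apply: eq_integral => x _.
  by rewrite patchE indicE; case: ifP => _; rewrite ?mule1 ?mule0.
pose f_ := nnsfun_approx measurableT mf.
transitivity (lim (\int[nu]_x (f_ n x)%:E @[n --> \oo])%E).
  rewrite -monotone_convergence//=.
  - apply: eq_integral => x _; apply/esym/cvg_lim => //=.
    exact: cvg_nnsfun_approx.
  - by move=> n; exact/measurable_EFinP/measurable_funTS.
  - by move=> n ? _; rewrite lee_fin.
  - by move=> ? _ ? ? mn; rewrite lee_fin; exact/lefP/nd_nnsfun_approx.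
under congr_lim do under eq_fun do rewrite sfunE.
rewrite -monotone_convergence//=.
- apply: eq_integral => x _; rewrite limeMl//.
    congr (_ * _)%E; apply/cvg_lim => //=; exact: cvg_nnsfun_approx.
  exact: (cvgP _ (cvg_nnsfun_approx measurableT mf (fun x _ => f0 x) (I : setT x))).
- by move=> n; apply: emeasurable_funM; exact/measurable_EFinP.
- by move=> n x _; rewrite mule_ge0 ?lee_fin.
- move=> x _ m n mn; rewrite lee_wpmul2l ?lee_fin//.
  exact/lefP/nd_nnsfun_approx.
Qed.

(** * Real n-space with its Borel sets, and iterated integrals over it *)

Section Rn.
Variable R : realType.

(** A separate name for the function type lets [borel_n] itself be its sigma-algebra, so that the
    measurability clauses of [code_ok] apply as they stand. *)
Definition rv n : Type := 'I_n -> R.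

HB.instance Definition _ n := Pointed.copy (rv n) ('I_n -> R).
HB.instance Definition _ n := @isMeasurable.Build default_measure_display
  (rv n) (@borel_n R n) (@sigma_algebra0 _ setT (@boxes R n))
  (@sigma_algebraC _ (@boxes R n)) (@sigma_algebra_bigcup _ setT (@boxes R n)).

Lemma measurable_coord n (i : 'I_n) :
  measurable_fun setT (fun v : rv n => v i : R).
Proof.
move=> _ B mB; rewrite setTI; apply: sub_sigma_algebra.
exists (fun j => if j == i then B else setT); split.
  by move=> j; case: ifP.
apply/seteqP; split => [v Bv j|v /(_ i)]; last by rewrite eqxx.
by case: eqP => // ->.
Qed.

Lemma measurable_rvP n d (T : measurableType d) (f : T -> rv n) :
  (forall i, measurable_fun setT (fun t => f t i : R)) -> measurable_fun setT f.
Proof.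
move=> mf; apply: (@measurability _ _ T (rv n) setT f (@boxes R n)) => //.
move=> _ [_ [F [mF ->]] <-]; rewrite setTI.
rewrite (_ : _ @^-1` _ = \bigcap_(i in [set: 'I_n]) (f ^~ i @^-1` F i)).
  apply: fin_bigcap_measurable => // i _; rewrite -[X in measurable X]setTI.
  exact: mf.
by apply/seteqP; split => t /= h i; [move=> _|]; exact: h.
Qed.

Lemma vcons0 n x (v : 'I_n -> R) : vcons x v ord0 = x.
Proof. by rewrite /vcons unlift_none. Qed.

Lemma vconsS n x (v : 'I_n -> R) i : vcons x v (lift ord0 i) = v i.
Proof. by rewrite /vcons liftK. Qed.

Definition vcons_pair n (p : measurableTypeR R * rv n) : rv n.+1 := vcons p.1 p.2.

Lemma measurable_vcons_pair n : measurable_fun setT (@vcons_pair n).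
Proof.
apply: measurable_rvP => i; case: (unliftP ord0 i) => [j|] ->.
- rewrite /vcons_pair; under eq_fun do rewrite vconsS.
  exact: (measurableT_comp (measurable_coord j) measurable_snd).
- rewrite /vcons_pair; under eq_fun do rewrite vcons0.
  exact: measurable_fst.
Qed.

Lemma iint_ge0 n (F : rv n -> \bar R) :
  (forall v, 0 <= F v)%E -> (0 <= iint F)%E.
Proof.
elim: n F => [|n IH] F F0 //=.
by apply: integral_ge0 => x _; apply: IH => v.
Qed.

Lemma eq_iint n (F G : rv n -> \bar R) : F =1 G -> iint F = iint G.
Proof. by move=> /funext ->. Qed.

(** The parameter space [T] is general because the induction feeds on it: the outermost coordinate
    joins the parameter while the inner integral is treated, and Tonelli then integrates that
    coordinate. *)
Lemma measurable_iint n d (T : measurableType d) (F : T -> rv n -> \bar R) :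
  measurable_fun setT (fun p : T * rv n => F p.1 p.2) ->
  (forall t v, 0 <= F t v)%E ->
  measurable_fun setT (fun t => iint (F t)).
Proof.
elim: n d T F => [|n IH] d T F mF F0 /=.
  apply: (measurableT_comp mF (g := fun t => (t, (fun=> 0) : rv 0))).
  by apply/measurable_fun_pair => //; exact: measurable_cst.
pose H (p : T * measurableTypeR R) := iint (fun v => F p.1 (vcons p.2 v)).
have mH : measurable_fun setT H.
  apply: (IH _ _ (fun (p : T * measurableTypeR R) v => F p.1 (vcons p.2 v))) => //.
  apply: (measurableT_comp mF
    (g := fun q : (T * measurableTypeR R) * rv n => (q.1.1, vcons q.1.2 q.2 : rv n.+1))).
  apply/measurable_fun_pair => /=.
    exact: (measurableT_comp measurable_fst measurable_fst).
  apply: (measurableT_comp (@measurable_vcons_pair n)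
    (g := fun q : (T * measurableTypeR R) * rv n => (q.1.2, q.2))).
  apply/measurable_fun_pair => //=.
  exact: (measurableT_comp measurable_snd measurable_fst).
apply: (@measurable_fun_fubini_tonelli_F _ _ _ _ _ (@lebesgue_measure R) H mH).
by move=> p; apply: iint_ge0 => v.
Qed.

Lemma measurable_iint_vcons n (F : rv n.+1 -> \bar R) :
  measurable_fun setT F -> (forall v, 0 <= F v)%E ->
  measurable_fun setT (fun x : measurableTypeR R => iint (fun v => F (vcons x v))).
Proof.
move=> mF F0; apply: measurable_iint => //.
exact: (measurableT_comp mF (@measurable_vcons_pair n)).
Qed.

Lemma measurable_vcons n (x : R) :
  measurable_fun setT (fun v : rv n => vcons x v : rv n.+1).
Proof.
apply: (measurableT_comp (@measurable_vcons_pair n)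
  (g := fun v : rv n => (x : measurableTypeR R, v))).
by apply/measurable_fun_pair => //; exact: measurable_cst.
Qed.

Lemma iintZl n (c : R) (F : rv n -> \bar R) : 0 <= c ->
  measurable_fun setT F -> (forall v, 0 <= F v)%E ->
  (iint (fun v => c%:E * F v) = c%:E * iint F)%E.
Proof.
move=> c0; elim: n F => [|n IH] F mF F0 //=.
rewrite -ge0_integralZl_EFin//=.
- apply: eq_integral => x _; rewrite IH//.
  exact: (measurableT_comp mF (measurable_vcons x)).
- by move=> x _; exact: iint_ge0.
- exact: measurable_iint_vcons.
Qed.

(** The shifted Lebesgue measure agrees with the original on half-open intervals, hence everywhere
    by uniqueness. *)
Lemma ge0_integral_shift (h : R) (f : R -> \bar R) :
  measurable_fun setT f -> (forall x, 0 <= f x)%E ->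
  (\int[@lebesgue_measure R]_x f (x + h)%R = \int[@lebesgue_measure R]_x f x)%E.
Proof.
move=> mf f0; pose sh : measurableTypeR R -> measurableTypeR R := fun x => x + h.
have msh : measurable_fun setT sh.
  by apply: (@measurable_funD _ _ R setT id (cst h)) => //; exact: measurable_id.
transitivity (\int[pushforward (@lebesgue_measure R) sh]_x f x)%E.
  by rewrite ge0_integral_pushforward.
apply: eq_measure_integral => A mA _; apply/esym/lebesgue_measure_unique => //= _ [[a b]] _ <-.
rewrite /pushforward (_ : sh @^-1` _ = `](a - h), (b - h)]%classic).
  by rewrite !lebesgue_measure_itv/= !lte_fin ltrD2r -!EFinB; case: ifP => // _;
    congr (_%:E); ring.
by apply/seteqP; split => x /=; rewrite !in_itv/= ltrBlDr lerBrDr.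
Qed.

Lemma iint_shift n (h : 'I_n -> R) (F : rv n -> \bar R) :
  measurable_fun setT F -> (forall v, 0 <= F v)%E ->
  iint (fun v => F (fun i => v i + h i)) = iint F.
Proof.
elim: n h F => [|n IH] h F mF F0 /=.
  by congr F; apply/funext => -[].
rewrite -[RHS](@ge0_integral_shift (h ord0)).
- apply: eq_integral => x _.
  rewrite -(IH (fun i => h (lift ord0 i)) (fun v => F (vcons (x + h ord0) v)))//.
    apply: eq_iint => v; congr F; apply/funext => i.
    by case: (unliftP ord0 i) => [j|] ->; rewrite ?vconsS ?vcons0.
  exact: (measurableT_comp mF (measurable_vcons _)).
- exact: measurable_iint_vcons.
- by move=> x; exact: iint_ge0.
Qed.

End Rn.

Section product_probability.
Context d1 d2 (T1 : measurableType d1) (T2 : measurableType d2) (R : realType).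
Variables (P1 : probability T1 R) (P2 : probability T2 R).

Definition prodp : set (T1 * T2) -> \bar R := (P1 \x P2)%E.

HB.instance Definition _ := Measure.on prodp.

Lemma prodp_setT : prodp setT = 1%E.
Proof.
transitivity (P1 setT * P2 setT)%E; last by rewrite !probability_setT mule1.
by rewrite -setXTT; exact: product_measure1E.
Qed.

HB.instance Definition _ := Measure_isProbability.Build _ _ _ prodp prodp_setT.

Lemma ge0_integral_prodp (f : T1 * T2 -> \bar R) :
  measurable_fun setT f -> (forall x, 0 <= f x)%E ->
  (\int[prodp]_p f p = \int[P1]_x \int[P2]_y f (x, y))%E.
Proof. by move=> mf f0; rewrite /prodp fubini_tonelli1. Qed.

End product_probability.

(** * The Gaussian law on n-space and its likelihood ratios *)

Section Gaussian_measure.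
Variable R : realType.

HB.instance Definition _ n :=
  isMeasurableFun.Build _ _ _ _ (@vcons_pair R n) (@measurable_vcons_pair R n).

Lemma gauss_n_ge0 n (var : R) v : 0 <= gauss_n (n := n) var v.
Proof. by apply: prodr_ge0 => i _; exact: normal_pdf_ge0. Qed.

Lemma gauss_nS n (var : R) x (v : 'I_n -> R) :
  gauss_n var (vcons x v) = normal_pdf 0 (Num.sqrt var) x * gauss_n var v.
Proof.
rewrite /gauss_n big_ord_recl vcons0; congr (_ * _).
by apply: eq_bigr => i _; rewrite vconsS.
Qed.

Lemma measurable_gauss_n n (var : R) :
  measurable_fun setT (fun v : rv R n => gauss_n var v : R).
Proof.
rewrite /gauss_n; apply: measurable_prod => i _ _.
exact: (measurableT_comp (measurable_normal_pdf 0 (Num.sqrt var))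
  (measurable_coord i)).
Qed.

(** Bridge from the iterated density integrals that define the error probability to a genuine
    probability measure: normal coordinates are added one at a time by pushing a product forward
    along [vcons_pair], starting from the Dirac mass on the one-point space. *)
Lemma gauss_prob_exists n (var : R) :
  exists G : probability (rv R n) R, forall F : rv R n -> \bar R,
    measurable_fun setT F -> (forall v, 0 <= F v)%E ->
    (iint (fun v => (gauss_n var v)%:E * F v) = \int[G]_v F v)%E.
Proof.
elim: n => [|n [G GE]].
  exists (\d_ ((fun=> 0) : rv R 0) : probability _ _) => F mF F0.
  rewrite integral_dirac//= diracT mul1e /gauss_n big_ord0 mul1e.
  by [].
pose Nrm : probability (measurableTypeR R) R := normal_prob 0 (Num.sqrt var).
exists (distribution (prodp Nrm G) (@vcons_pair R n)) => F mF F0.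
have mFv := measurableT_comp mF (@measurable_vcons_pair R n).
rewrite ge0_integral_distribution// ge0_integral_prodp//=.
have mI : measurable_fun setT
    (fun x : measurableTypeR R => \int[G]_v F (vcons x v))%E.
  apply: (measurable_fun_fubini_tonelli_F (m2 := G) (F \o @vcons_pair R n)) => //.
  by move=> p; exact: F0.
rewrite [RHS](@ge0_integral_density _ _ _ (@lebesgue_measure R) Nrm
  (normal_pdf 0 (Num.sqrt var)))//=.
- apply: eq_integral => x _; rewrite -GE//; last first.
    exact: (measurableT_comp mF (@measurable_vcons R n x)).
  rewrite -iintZl ?normal_pdf_ge0//.
  + by apply: eq_iint => v; rewrite gauss_nS EFinM muleA.
  + apply: emeasurable_funM; first by apply/measurable_EFinP; exact: measurable_gauss_n.
    exact: (measurableT_comp mF (@measurable_vcons R n x)).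
  + by move=> v; rewrite mule_ge0// lee_fin gauss_n_ge0.
- exact: measurable_normal_pdf.
- by move=> x; exact: normal_pdf_ge0.
- by move=> x; exact: integral_ge0.
Qed.

Definition gaussP n (var : R) : probability (rv R n) R :=
  projT1 (cid (gauss_prob_exists n var)).

Lemma GamE n (var : R) (F : rv R n -> \bar R) :
  measurable_fun setT F -> (forall v, 0 <= F v)%E ->
  (iint (fun v => (gauss_n var v)%:E * F v) = \int[gaussP n var]_v F v)%E.
Proof. by rewrite /gaussP; case: cid => G GE /=; exact: GE. Qed.

Lemma gauss_nE n (var : R) (v : 'I_n -> R) : 0 < var ->
  gauss_n var v =
  expR (- (n%:R / 2 * ln (2 * pi * var) + (\sum_i v i ^+ 2) / (2 * var))).
Proof.
move=> var0; have s0 : Num.sqrt var != 0 by rewrite gt_eqF ?sqrtr_gt0.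
have p0 : 0 < 2 * pi * var :> R by rewrite !mulr_gt0 ?pi_gt0.
rewrite /gauss_n normal_pdfE// big_split /= prodr_const card_ord.
have -> : normal_peak (Num.sqrt var) = expR (- (2^-1 * ln (2 * pi * var))).
  rewrite /normal_peak sqr_sqrtr ?ltW// expRN; congr (_^-1).
  rewrite (_ : var * pi *+ 2 = 2 * pi * var); last by rewrite -mulr_natl; ring.
  rewrite -powR12_sqrt ?ltW// /powR gt_eqF//.
rewrite -expRM_natl /normal_fun -expR_sum -expRD; congr expR.
rewrite opprD mulrN -mulr_natl; congr (_ + _); first by field.
rewrite mulr_suml -sumrN; apply: eq_bigr => i _.
by rewrite subr0 sqr_sqrtr ?ltW// mulNr -[_ *+ 2]mulr_natl.
Qed.

Lemma gauss_n_gt0 n (var : R) (v : 'I_n -> R) : 0 < var -> 0 < gauss_n var v.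
Proof. by move=> var0; rewrite gauss_nE// expR_gt0. Qed.

Lemma measurable_sum_sqr n :
  measurable_fun setT (fun v : rv R n => \sum_i v i ^+ 2 : R).
Proof.
apply: measurable_sum => i.
exact: (measurable_funX 2 (measurable_coord i)).
Qed.

Lemma measurable_gauss_nV n (var : R) : 0 < var ->
  measurable_fun setT (fun v : rv R n => (gauss_n var v)^-1 : R).
Proof.
move=> var0; under eq_fun do rewrite gauss_nE// -expRN opprK.
apply: measurableT_comp => //; apply: measurable_funD => //.
by apply: measurable_funM => //; exact: measurable_sum_sqr.
Qed.

Lemma measurable_rv_shift n (h : 'I_n -> R) :
  measurable_fun setT (fun v : rv R n => (fun i => v i + h i) : rv R n).
Proof.
apply: measurable_rvP => i.
by apply: measurable_funD; [exact: measurable_coord|exact: measurable_cst].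
Qed.

(** The ratio trades the law N(0, [var]) for N(-[h], [var']): cancelling [gauss_n var v] leaves a
    Lebesgue integral, which is translation invariant. *)
Lemma gaussP_change n (var var' : R) (h : 'I_n -> R) (F : rv R n -> \bar R) :
  0 < var -> measurable_fun setT F -> (forall v, 0 <= F v)%E ->
  (\int[gaussP n var]_v
     ((gauss_n var' (fun i => v i + h i)%R / gauss_n var v)%:E * F v)
   = \int[gaussP n var']_v F (fun i => v i - h i)%R)%E.
Proof.
move=> var0 mF F0.
have mFh : measurable_fun setT (fun v : rv R n => F (fun i => v i - h i)).
  exact: (measurableT_comp mF (@measurable_rv_shift n (fun i => - h i))).
have mg : measurable_fun setT
    (fun v : rv R n => gauss_n var' (fun i => v i + h i)%R : R).
  exact: (measurableT_comp (@measurable_gauss_n n var') (@measurable_rv_shift n h)).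
rewrite -!GamE//.
- rewrite -[RHS](iint_shift h)//.
  + apply: eq_iint => v; rewrite muleA -EFinM mulrC divfK ?gt_eqF ?gauss_n_gt0//.
    by congr (_ * F _)%E; apply/funext => i; rewrite addrK.
  + apply: (@emeasurable_funM _ _ _ _ (fun v : rv R n => (gauss_n var' v)%:E)) => //.
    by apply/measurable_EFinP; exact: measurable_gauss_n.
  + by move=> v; rewrite mule_ge0// lee_fin gauss_n_ge0.
- apply: emeasurable_funM => //; apply/measurable_EFinP.
  by apply: measurable_funM => //; exact: measurable_gauss_nV.
- by move=> v; rewrite mule_ge0// lee_fin divr_ge0 ?gauss_n_ge0.
Qed.

(** Read as a family of identities in [var'] and [h], this yields the Gaussian moments by expansion
    near [var' = var] and [h = 0], in place of integration by parts. *)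
Lemma gaussP_change1 n (var var' : R) (h : 'I_n -> R) : 0 < var ->
  (\int[gaussP n var]_v
     (gauss_n var' (fun i => v i + h i)%R / gauss_n var v)%:E = 1)%E.
Proof.
move=> var0; under eq_integral do rewrite -[(_%:E)]mule1.
by rewrite (@gaussP_change n var var' h (cst 1%E))// integral_cst// mul1e;
  exact: probability_setT.
Qed.

End Gaussian_measure.

(** * First-order comparison, and a quadratic bound on the exponential *)

Section elementary.
Variable R : realType.
Implicit Types a C e t u : R.

(** Dividing by [t] and letting [t] tend to 0 would do; a single [t] so small that [C * t <= a / 2]
    already contradicts [0 < a]. *)
Lemma le0_of_lin_le_quad a C e : 0 < e ->
  (forall t, 0 < t <= e -> a * t <= C * t ^+ 2) -> a <= 0.
Proof.
move=> e0 H; rewrite leNgt; apply/negP => a0.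
have D0 : 0 < `|C| + 1 by rewrite ltr_wpDl.
pose t := Num.min e (a / (2 * (`|C| + 1))).
have t0 : 0 < t by rewrite lt_min e0 divr_gt0// mulr_gt0.
have := H t; rewrite t0 ge_min lexx /= => /(_ isT).
rewrite expr2 mulrA ler_pM2r// => aCt.
have : C * t <= a / 2.
  apply: (@le_trans _ _ ((`|C| + 1) * t)).
    by rewrite ler_pM2r// ler_wpDr// ler_norm.
  apply: (@le_trans _ _ ((`|C| + 1) * (a / (2 * (`|C| + 1))))).
    by rewrite ler_pM2l// ge_min lexx orbT.
  rewrite le_eqVlt; apply/orP; left; apply/eqP; field.
  by rewrite gt_eqF.
lra.
Qed.

Lemma eq0_of_lin_le_quad a C e : 0 < e ->
  (forall t, `|t| <= e -> a * t <= C * t ^+ 2) -> a = 0.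
Proof.
move=> e0 H; apply/eqP; rewrite eq_le; apply/andP; split.
  apply: (@le0_of_lin_le_quad _ C e) => // t /andP[t0 te].
  by apply: H; rewrite gtr0_norm.
rewrite -oppr_le0; apply: (@le0_of_lin_le_quad _ C e) => // t /andP[t0 te].
have := H (- t); rewrite normrN gtr0_norm// => /(_ te).
by rewrite sqrrN mulrN mulNr.
Qed.

(** Invert [1 - u <= expR (- u)]; the bound then rests on (1 + u + 2 u^2)(1 - u) = 1 + u^2 (1 - 2
    u), which is at least 1 in this range. *)
Lemma expR_le_quad u : u <= 2^-1 -> expR u <= 1 + u + 2 * u ^+ 2.
Proof.
move=> u2; have := expR_ge1Dx (- u); rewrite expRN => h.
have E0 := expR_gt0 u.
have h2 : (1 - u) * expR u <= 1 by rewrite -ler_pdivlMr ?div1r.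
have : 1 <= (1 + u + 2 * u ^+ 2) * (1 - u).
  have -> : (1 + u + 2 * u ^+ 2) * (1 - u) = 1 + u ^+ 2 * (1 - 2 * u) by ring.
  rewrite lerDl mulr_ge0 ?sqr_ge0//; lra.
move=> h3; rewrite -(@ler_pM2r _ (1 - u)); last lra.
by rewrite mulrC; exact: (le_trans h2).
Qed.

End elementary.

(** * Expectation, and the inner product of square-integrable functions *)

Section L2.
Context d (T : measurableType d) (R : realType) (P : probability T R).
Implicit Types (f g h : T -> R).

Definition intgb f := P.-integrable setT (EFin \o f).
Definition Ex f : R := (\int[P]_x f x)%R.

Lemma ge0_intgb f : measurable_fun setT f -> (forall x, 0 <= f x) ->
  (\int[P]_x (f x)%:E < +oo)%E -> intgb f.
Proof.
move=> mf f0 fi; apply/integrableP; split; first exact/measurable_EFinP.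
by under eq_integral do rewrite /= ger0_norm//.
Qed.

Lemma intgb_meas f : intgb f -> measurable_fun setT f.
Proof. by move=> /integrableP[/measurable_EFinP]. Qed.

Lemma le_intgb f g : measurable_fun setT f -> (forall x, `|f x| <= g x) ->
  intgb g -> intgb f.
Proof.
move=> mf fg ig; apply: (le_integrable _ _ _ ig) => //.
  exact/measurable_EFinP.
by move=> x _ /=; rewrite lee_fin (le_trans (fg x))// ler_norm.
Qed.

Lemma ExE f : intgb f -> (Ex f)%:E = (\int[P]_x (f x)%:E)%E.
Proof. by move=> fi; rewrite /Ex /Rintegral fineK//; exact: integrable_fin_num. Qed.

Lemma intgb_cst (c : R) : intgb (fun=> c).
Proof. exact: finite_measure_integrable_cst. Qed.

Lemma Ex_cst (c : R) : Ex (fun=> c) = c.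
Proof.
rewrite /Ex Rintegral_cst//.
transitivity (c * fine (1%E : \bar R)); last by rewrite /= mulr1.
congr (_ * fine _); exact: probability_setT.
Qed.

Lemma intgbD f g : intgb f -> intgb g -> intgb (fun x => f x + g x).
Proof. by move=> fi gi; exact: (integrableD measurableT fi gi). Qed.

Lemma intgbZ (a : R) f : intgb f -> intgb (fun x => a * f x).
Proof. by move=> fi; exact: (integrableZl measurableT a fi). Qed.

Lemma ExD f g : intgb f -> intgb g -> Ex (fun x => f x + g x) = Ex f + Ex g.
Proof. by move=> fi gi; exact: RintegralD. Qed.

Lemma ExZ (a : R) f : intgb f -> Ex (fun x => a * f x) = a * Ex f.
Proof. by move=> fi; exact: RintegralZl. Qed.

Lemma intgb_sum (I : Type) (r : seq I) (F : I -> T -> R) :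
  (forall i, intgb (F i)) -> intgb (fun x => \sum_(i <- r) F i x).
Proof.
move=> iF; elim: r => [|i r IH].
  by under eq_fun do rewrite big_nil; exact: intgb_cst.
by under eq_fun do rewrite big_cons; exact: intgbD.
Qed.

Lemma Ex_sum (I : Type) (r : seq I) (F : I -> T -> R) :
  (forall i, intgb (F i)) ->
  Ex (fun x => \sum_(i <- r) F i x) = \sum_(i <- r) Ex (F i).
Proof.
move=> iF; elim: r => [|i r IH].
  by under eq_fun do rewrite big_nil; rewrite big_nil Ex_cst.
under eq_fun do rewrite big_cons.
by rewrite big_cons ExD ?IH//; exact: intgb_sum.
Qed.

Lemma Ex_le f g : intgb f -> intgb g -> (forall x, f x <= g x) -> Ex f <= Ex g.
Proof. by move=> fi gi fg; apply: le_Rintegral => // x _; exact: fg. Qed.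

Lemma eq_Ex f g : f =1 g -> Ex f = Ex g.
Proof. by move=> /funext ->. Qed.

Definition L2 f := measurable_fun setT f /\ intgb (fun x => f x ^+ 2).
Definition ip f g : R := Ex (fun x => f x * g x).

Lemma L2_mul f g : L2 f -> L2 g -> intgb (fun x => f x * g x).
Proof.
move=> [mf fi] [mg gi]; apply: (le_intgb _ _ (intgbD fi gi)).
  exact: measurable_funM.
move=> x; rewrite ler_norml; apply/andP; split.
- have := sqr_ge0 (f x + g x); have := sqr_ge0 (f x); have := sqr_ge0 (g x).
  rewrite sqrrD; nra.
- have := sqr_ge0 (f x - g x); have := sqr_ge0 (f x); have := sqr_ge0 (g x).
  rewrite sqrrB; nra.
Qed.

Lemma L2_cst (c : R) : L2 (fun=> c).
Proof. by split; [exact: measurable_cst|exact: intgb_cst]. Qed.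

Lemma L2_comb (a b : R) f g : L2 f -> L2 g -> L2 (fun x => a * f x + b * g x).
Proof.
move=> fi gi; split.
  case: fi gi => [mf _] [mg _].
  by apply: measurable_funD; apply: measurable_funM => //; exact: measurable_cst.
have -> : (fun x => (a * f x + b * g x) ^+ 2) =
    (fun x => a ^+ 2 * (f x ^+ 2) + (2 * a * b * (f x * g x) + b ^+ 2 * g x ^+ 2)).
  by apply/funext => x; ring.
apply: intgbD; first by apply: intgbZ; case: fi.
apply: intgbD; first by apply: intgbZ; exact: L2_mul.
by apply: intgbZ; case: gi.
Qed.

Lemma L2_intgb f : L2 f -> intgb f.
Proof.
move=> fi; have -> : f = fun x => f x * 1 by apply/funext => x; rewrite mulr1.
by apply: L2_mul => //; exact: L2_cst.
Qed.

Lemma ipC f g : ip f g = ip g f.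
Proof. by apply: eq_Ex => x; rewrite mulrC. Qed.

Lemma ip_comb (a b : R) f g h : L2 f -> L2 g -> L2 h ->
  ip (fun x => a * f x + b * g x) h = a * ip f h + b * ip g h.
Proof.
move=> fi gi hi; rewrite -!ExZ; try exact: L2_mul.
rewrite -ExD; try (by apply: intgbZ; exact: L2_mul).
by apply: eq_Ex => x; ring.
Qed.

Lemma ip_cst (c : R) f : L2 f -> ip (fun=> c) f = c * Ex f.
Proof. by move=> fi; rewrite -ExZ//; exact: L2_intgb. Qed.

(** One expansion for all squared residuals in the log-likelihood ratios; the four functions will be
    [x], [X2], [S] and [Z] at one time. *)
Lemma sqr_comb4 (k1 k2 k3 k4 : R) f1 f2 f3 f4 : L2 f1 -> L2 f2 -> L2 f3 -> L2 f4 ->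
  L2 (fun x => k1 * f1 x + k2 * f2 x + k3 * f3 x + k4 * f4 x) /\
  Ex (fun x => (k1 * f1 x + k2 * f2 x + k3 * f3 x + k4 * f4 x) ^+ 2) =
  k1 ^+ 2 * ip f1 f1 + k2 ^+ 2 * ip f2 f2 + k3 ^+ 2 * ip f3 f3
  + k4 ^+ 2 * ip f4 f4 + 2 * (k1 * k2 * ip f1 f2 + k1 * k3 * ip f1 f3
  + k1 * k4 * ip f1 f4 + k2 * k3 * ip f2 f3 + k2 * k4 * ip f2 f4
  + k3 * k4 * ip f3 f4).
Proof.
move=> l1 l2 l3 l4.
pose g1 x := k1 * f1 x + k2 * f2 x; pose g2 x := k3 * f3 x + k4 * f4 x.
have lg1 : L2 g1 by exact: L2_comb.
have lg2 : L2 g2 by exact: L2_comb.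
have gE : (fun x => k1 * f1 x + k2 * f2 x + k3 * f3 x + k4 * f4 x) =
    (fun x => 1 * g1 x + 1 * g2 x).
  by apply/funext => x; rewrite /g1 /g2; ring.
rewrite gE; have lg : L2 (fun x => 1 * g1 x + 1 * g2 x) by exact: L2_comb.
split=> //.
transitivity (ip (fun x => 1 * g1 x + 1 * g2 x) (fun x => 1 * g1 x + 1 * g2 x)).
  by apply: eq_Ex => x; rewrite expr2 /g1 /g2; ring.
rewrite ip_comb// ![ip _ (fun x => 1 * _ + _)]ipC !ip_comb//.
rewrite !(ipC _ g1) !(ipC _ g2) !ip_comb//.
rewrite (ipC f2 f1) (ipC f3 f1) (ipC f4 f1) (ipC f3 f2) (ipC f4 f2) (ipC f4 f3).
ring.
Qed.

End L2.

(** * First and second moments of the Gaussian law *)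

Section moments.
Variable R : realType.
Implicit Types (n : nat) (var : R).

(** The likelihood ratio towards variance [var * expR t] has mean 1 for every [t]. Bounding it below
    by [1 + x <= expR x] and comparing to first order at [t = 0], for both signs of [t], forces the
    value of the moment. Integrability comes from the ratio at [t = 1], which dominates the sum of
    squares up to a constant. *)
Lemma gaussP_intgb_sumsq n var : 0 < var ->
  intgb (gaussP n var) (fun v => \sum_i v i ^+ 2) /\
  Ex (gaussP n var) (fun v => \sum_i v i ^+ 2) = n%:R * var.
Proof.
move=> var0; set S := (fun v : rv R n => _).
pose k t : R := (1 - expR (- t)) / var.
have S0 v : 0 <= S v by apply: sumr_ge0 => i _; exact: sqr_ge0.
have mS : measurable_fun setT S by exact: measurable_sum_sqr.
have me t : measurable_fun setT
    (fun v : rv R n => expR (- (n%:R / 2 * t)) * expR (k t / 2 * S v)).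
  apply: measurable_funM => //; apply: measurableT_comp => //.
  exact: measurable_funM.
have key t : (\int[gaussP n var]_v
    (expR (- (n%:R / 2 * t)) * expR (k t / 2 * S v))%:E = 1)%E.
  rewrite -(@gaussP_change1 R n var (var * expR t) (fun=> 0))//.
  apply: eq_integral => v _; congr (_%:E).
  have -> : (fun i => v i + 0) = v by apply/funext => i; rewrite addr0.
  rewrite !gauss_nE ?mulr_gt0 ?expR_gt0// -expRN -!expRD; congr expR.
  have -> : 2 * pi * (var * expR t) = (2 * pi * var) * expR t by rewrite !mulrA.
  rewrite lnM ?posrE ?expR_gt0 ?mulr_gt0 ?pi_gt0// expRK -/(S v) /k expRN.
  have := expR_gt0 t; set e := expR t => e0; field.
  by rewrite !gt_eqF.
have ie t : intgb (gaussP n var)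
    (fun v => expR (- (n%:R / 2 * t)) * expR (k t / 2 * S v)).
  by apply: ge0_intgb => //; rewrite key ltry.
have Ee t : Ex (gaussP n var)
    (fun v => expR (- (n%:R / 2 * t)) * expR (k t / 2 * S v)) = 1.
  by apply: EFin_inj; rewrite ExE// key.
have k1 : 0 < k 1.
  by rewrite divr_gt0// subr_gt0 -[ltRHS]expR0 ltr_expR oppr_lt0.
have iS : intgb (gaussP n var) S.
  apply: (le_intgb mS _ (intgbZ ((k 1 / 2)^-1 * expR (n%:R / 2 * 1)) (ie 1))).
  move=> v; rewrite ger0_norm// !mulrA -[_^-1 * _ * _]mulrA -expRD subrr expR0 mulr1.
  rewrite ler_pdivlMl ?divr_gt0//.
  by apply: le_trans (expR_ge1Dx _); rewrite lerDr.
split=> //; set X := Ex _ _.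
suff : X / var - n%:R = 0.
  by move/eqP; rewrite subr_eq0 => /eqP <-; rewrite divfK ?gt_eqF.
(* This radius keeps both n t / 2 and -t at most 1/2, the range of [expR_le_quad]. *)
pose e := (2 * (n%:R + 1))^-1 : R.
have n0 : 0 <= n%:R :> R by [].
have e0 : 0 < e by rewrite invr_gt0; nra.
have X0 : 0 <= X / var.
  apply: divr_ge0; last exact: ltW.
  have : Ex (gaussP n var) (fun=> 0) <= X by apply: Ex_le => //; exact: intgb_cst.
  by rewrite Ex_cst.
apply: (@eq0_of_lin_le_quad _ _ (2 * (X / var) + n%:R ^+ 2) e) => // t te.
have h1 : 1 + k t / 2 * X <= expR (n%:R / 2 * t).
  have : Ex (gaussP n var) (fun v => expR (- (n%:R / 2 * t)) * (1 + k t / 2 * S v)) <= 1.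
    rewrite -[leRHS](Ee t); apply: Ex_le => //.
      by apply/intgbZ/intgbD; [exact: intgb_cst|exact: intgbZ].
    by move=> v; rewrite ler_pM2l ?expR_gt0// expR_ge1Dx.
  rewrite ExZ; last by apply/intgbD; [exact: intgb_cst|exact: intgbZ].
  rewrite ExD ?ExZ ?Ex_cst//; [|exact: intgb_cst|exact: intgbZ].
  by rewrite expRN -/X mulrC ler_pdivrMr ?expR_gt0// mul1r.
have tn : n%:R / 2 * t <= 2^-1.
  apply: (@le_trans _ _ (n%:R / 2 * e)).
    by rewrite ler_wpM2l ?divr_ge0// (le_trans (ler_norm t)).
  have : n%:R * e <= 1 by rewrite /e ler_pdivrMr ?mul1r; nra.
  lra.
have tt : - t <= 2^-1.
  rewrite (le_trans (ler_norm _))// normrN (le_trans te)// /e lef_pV2 ?posrE//; nra.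
have h2 := expR_le_quad tn; have h3 := expR_le_quad tt.
have h4 : X / var * (1 - expR (- t)) / 2 <= n%:R / 2 * t + 2 * (n%:R / 2 * t) ^+ 2.
  have -> : X / var * (1 - expR (- t)) / 2 = k t / 2 * X by rewrite /k; ring.
  lra.
have h5 : X / var * (t - 2 * t ^+ 2) <= X / var * (1 - expR (- t)).
  by apply: ler_wpM2l => //; rewrite sqrrN in h3; lra.
rewrite !mulrBl !mulrDl; nra.
Qed.

(** The same device with a translation in place of a dilation: the ratio for a shift by [m] in
    coordinate [i] has mean 1, so m X / var <= m^2 / (2 var) for both signs of [m]. *)
Lemma gaussP_intgb_coord n var i : 0 < var -> intgb (gaussP n var) (fun v => v i) /\
  Ex (gaussP n var) (fun v => v i) = 0.
Proof.
move=> var0; have [iS _] := gaussP_intgb_sumsq n var0.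
have ic : intgb (gaussP n var) (fun v => v i).
  apply: (le_intgb _ _ (intgbD (intgb_cst _ 1) iS)).
    exact: measurable_coord.
  move=> v; have : v i ^+ 2 <= \sum_j v j ^+ 2.
    by rewrite (bigD1 i)//= lerDl; apply: sumr_ge0 => j _; exact: sqr_ge0.
  have := sqr_ge0 (v i - 1); have := sqr_ge0 (v i + 1).
  rewrite ler_norml sqrrD sqrrB; nra.
split=> //; set X := Ex _ _.
have v20 : 0 < var^-1 by rewrite invr_gt0.
suff : X / var = 0 by move/eqP; rewrite mulf_eq0 invr_eq0 (gt_eqF var0) orbF => /eqP.
apply: (@eq0_of_lin_le_quad _ _ (var^-1 / 2) 1) => // m _.
pose h j : R := if j == i then - m else 0.
pose g (v : rv R n) : R := m / var * v i - m ^+ 2 / (2 * var).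
have mg : measurable_fun setT (fun v => expR (g v)).
  apply: measurableT_comp => //; apply: measurable_funB => //.
  by apply: measurable_funM => //; exact: measurable_coord.
have key : (\int[gaussP n var]_v (expR (g v))%:E = 1)%E.
  rewrite -(@gaussP_change1 R n var var h)//; apply: eq_integral => v _; congr (_%:E).
  rewrite !gauss_nE// -expRN -!expRD; congr expR.
  have -> : \sum_j (v j + h j) ^+ 2 = \sum_j v j ^+ 2 - 2 * m * v i + m ^+ 2.
    rewrite (bigD1 i)//= [in RHS](bigD1 i)//= {1}/h eqxx.
    under eq_bigr => j ji do rewrite /h (negbTE ji) addr0.
    by ring.
  by rewrite /g; field; rewrite gt_eqF.
have ie : intgb (gaussP n var) (fun v => expR (g v)).
  by apply: ge0_intgb => //; rewrite key ltry.
have Ee : Ex (gaussP n var) (fun v => expR (g v)) = 1.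
  by apply: EFin_inj; rewrite ExE// key.
have ig : intgb (gaussP n var) g.
  by apply: intgbD; [exact: intgbZ|exact: intgb_cst].
have : Ex (gaussP n var) (fun v => 1 + g v) <= 1.
  rewrite -[leRHS]Ee; apply: Ex_le => //; first by apply: intgbD => //; exact: intgb_cst.
  by move=> v; exact: expR_ge1Dx.
rewrite ExD//; last exact: intgb_cst.
rewrite Ex_cst /g ExD; [|exact: intgbZ|exact: intgb_cst].
rewrite ExZ// Ex_cst -/X.
have -> : m ^+ 2 / (2 * var) = var^-1 / 2 * m ^+ 2 by field; rewrite gt_eqF.
have -> : m / var * X = X / var * m by ring.
lra.
Qed.

End moments.

(** * Expectations under a product law *)

Section product_expectation.
Context d1 d2 (T1 : measurableType d1) (T2 : measurableType d2) (R : realType).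
Variables (P1 : probability T1 R) (P2 : probability T2 R).
Let P : probability _ R := prodp P1 P2.

Lemma integral_prob_cst d (T : measurableType d) (Pr : probability T R) (c : R) :
  (\int[Pr]_x c%:E = c%:E)%E.
Proof.
rewrite integral_cst//; transitivity (c%:E * 1)%E; last by rewrite mule1.
congr (_ * _)%E; exact: probability_setT.
Qed.

Lemma prodp_fst (f : T1 -> R) : intgb P1 f ->
  intgb P (fun p => f p.1) /\ Ex P (fun p => f p.1) = Ex P1 f.
Proof.
move=> fi; have mf := intgb_meas fi.
have mfst : measurable_fun setT (fun p : T1 * T2 => f p.1).
  exact: (measurableT_comp mf measurable_fst).
have i1 : intgb P (fun p => f p.1).
  apply/integrableP; split; first exact/measurable_EFinP.
  rewrite ge0_integral_prodp//=; last first.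
    by apply/measurable_EFinP; exact: measurableT_comp.
  under eq_integral do rewrite integral_prob_cst.
  by case/integrableP : fi.
split=> //; rewrite /Ex /Rintegral; congr fine.
transitivity (\int[P1]_x \int[P2]_y (f x)%:E)%E; last first.
  by apply: eq_integral => x _; rewrite integral_prob_cst.
by rewrite (integral12_prod_meas1 i1).
Qed.

Lemma prodp_snd (f : T2 -> R) : intgb P2 f ->
  intgb P (fun p => f p.2) /\ Ex P (fun p => f p.2) = Ex P2 f.
Proof.
move=> fi; have mf := intgb_meas fi.
have msnd : measurable_fun setT (fun p : T1 * T2 => f p.2).
  exact: (measurableT_comp mf measurable_snd).
have i1 : intgb P (fun p => f p.2).
  apply/integrableP; split; first exact/measurable_EFinP.
  rewrite ge0_integral_prodp//=; last first.
    by apply/measurable_EFinP; exact: measurableT_comp.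
  case/integrableP : fi => _ fi.
  have f0 : (0 <= \int[P2]_y `|f y|%:E)%E by exact: integral_ge0.
  have ff : (\int[P2]_y `|f y|%:E \is a fin_num)%E by rewrite ge0_fin_numE.
  by rewrite -(fineK ff) integral_prob_cst ltry.
split=> //; rewrite /Ex /Rintegral; congr fine.
transitivity (\int[P2]_y \int[P1]_x (f y)%:E)%E; last first.
  by apply: eq_integral => x _; rewrite integral_prob_cst.
by rewrite (integral21_prod_meas1 i1).
Qed.

Lemma ip_prodp0 (f : T1 -> R) (g : T2 -> R) :
  intgb P (fun p => f p.1 * g p.2) -> intgb P2 g -> Ex P2 g = 0 ->
  ip P (fun p => f p.1) (fun p => g p.2) = 0.
Proof.
move=> fgi gi g0; rewrite /ip /Ex /Rintegral -(integral12_prod_meas1 fgi) /fubini_F /=.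
transitivity (fine (\int[P1]_x (0 : \bar R))%E : R); last by rewrite integral0.
congr fine; apply: eq_integral => x _.
under eq_integral do rewrite EFinM.
by rewrite integralZl// -ExE// g0 mule0.
Qed.

End product_expectation.

(** * Change of measure and disjoint decoding events *)

Section information.
Context d (T : measurableType d) (R : realType) (P : probability T R).

Lemma intgb_indic (A : set T) : measurable A -> intgb P (\1_A : T -> R).
Proof.
move=> mA; apply: (le_intgb _ _ (intgb_cst P 1)).
  exact: measurable_indic.
by move=> x; rewrite indicE; case: (_ \in _); rewrite ?normr1 ?normr0.
Qed.

Lemma Ex_indic (A : set T) : measurable A -> Ex P (\1_A : T -> R) = fine (P A).
Proof. by move=> mA; rewrite /Ex /Rintegral integral_indic// setIT. Qed.

(* Weak converse by change of measure: with [expR (- L)] the density of a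
   reference measure, this is [x <= expR x - 1] at [x = t 1_A - L]. *)
Lemma change_of_measure_converse (L : T -> R) (A : set T) (t kappa : R) :
  intgb P L -> measurable A ->
  (\int[P]_x (expR (- L x))%:E <= 1)%E ->
  (\int[P]_x (expR (- L x) * \1_A x)%:E <= kappa%:E)%E ->
  t * fine (P A) <= Ex P L + expR t * kappa.
Proof.
move=> Li mA e1 ek.
have me : measurable_fun setT (fun x => expR (- L x)).
  by apply: measurableT_comp => //; apply: measurableT_comp => //; exact: intgb_meas Li.
have ie : intgb P (fun x => expR (- L x)).
  by apply: ge0_intgb => //; rewrite (le_lt_trans e1)// ltry.
have ieA : intgb P (fun x => expR (- L x) * \1_A x).
  apply: ge0_intgb.
  - by apply: measurable_funM => //; exact: measurable_indic.
  - by move=> x; rewrite mulr_ge0 ?expR_ge0.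
  - by rewrite (le_lt_trans ek)// ltry.
have E1 : Ex P (fun x => expR (- L x)) <= 1 by rewrite -lee_fin ExE.
have E2 : Ex P (fun x => expR (- L x) * \1_A x) <= kappa by rewrite -lee_fin ExE.
have iA := intgb_indic mA.
have i3 : intgb P (fun x => expR t * (expR (- L x) * \1_A x)) by exact: intgbZ.
have i2 : intgb P (fun x => expR (- L x) + expR t * (expR (- L x) * \1_A x)).
  exact: intgbD.
have ic := intgb_cst P (-1).
have i4 : intgb P (fun x => L x + (-1)) by exact: intgbD.
have : Ex P (fun x => t * \1_A x) <=
    Ex P (fun x => (L x + (-1)) + (expR (- L x) + expR t * (expR (- L x) * \1_A x))).
  apply: Ex_le; [exact: intgbZ|exact: intgbD|move=> x].
  have := expR_ge1Dx (t * \1_A x - L x); rewrite expRD indicE.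
  have := expR_gt0 (- L x); have := expR_gt0 t.
  by case: (_ \in _); rewrite ?mulr1 ?mulr0 ?expR0; nra.
rewrite ExZ// Ex_indic// ExD// ExD// Ex_cst ExD// ExZ// => h.
have : expR t * Ex P (fun x => expR (- L x) * \1_A x) <= expR t * kappa.
  by rewrite ler_pM2l ?expR_gt0.
lra.
Qed.

(** At each point at most one indicator is 1. Applied to decoding events under a reference law, it
    says that a guess independent of the message has total success at most 1 over all messages. *)
Lemma sum_disjoint_le1 (I : finType) (A : I -> set T) :
  (forall i, measurable (A i)) ->
  (forall i j x, A i x -> A j x -> i = j) -> \sum_i fine (P (A i)) <= 1.
Proof.
move=> mA dA; under eq_bigr do rewrite -Ex_indic//.
rewrite -Ex_sum; last by move=> i; exact: intgb_indic.
rewrite -[leRHS](Ex_cst P 1); apply: Ex_le => [||x].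
- by apply: intgb_sum => i; exact: intgb_indic.
- exact: intgb_cst.
have [[i Aix]|nA] := pselect (exists i, A i x); last first.
  rewrite big1// => i _; rewrite indicE memNset// => Aix; apply: nA.
  by exists i.
rewrite (bigD1 i)//= big1 ?addr0 ?indicE; first by case: (_ \in _).
by move=> j ji; rewrite indicE memNset// => /(dA _ _ _ Aix)/eqP; rewrite eq_sym (negbTE ji).
Qed.

End information.

(** * Replacing the law of the noise, then that of the state *)

Section gaussian_change.
Variable R : realType.

(** [gaussP_change] in the second block for each fixed first block; the shift depends on the state
    because the informed encoder does. *)
Lemma prodp_change n (Q N var : R) (h : rv R n -> rv R n)
    (F : rv R n * rv R n -> \bar R) : 0 < N ->
  measurable_fun setT h -> measurable_fun setT F -> (forall p, 0 <= F p)%E ->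
  (\int[prodp (gaussP n Q) (gaussP n N)]_p
     ((gauss_n var (fun i => p.2 i + h p.1 i)%R / gauss_n N p.2)%:E * F p)
   = \int[prodp (gaussP n Q) (gaussP n var)]_p
       F (p.1, (fun i => p.2 i - h p.1 i)%R))%E.
Proof.
move=> N0 mh mF F0.
have mF1 s : measurable_fun setT (fun z : rv R n => F (s, z)).
  by apply: (measurableT_comp mF); exact: pair1_measurable.
pose f1 (p : rv R n * rv R n) :=
  ((gauss_n var (fun i => p.2 i + h p.1 i)%R / gauss_n N p.2)%:E * F p)%E.
pose f2 (p : rv R n * rv R n) := F (p.1, (fun i => p.2 i - h p.1 i)%R).
have mhi i : measurable_fun setT (fun p : rv R n * rv R n => h p.1 i : R).
  exact: (measurableT_comp (measurable_coord i) (measurableT_comp mh measurable_fst)).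
have m2i i : measurable_fun setT (fun p : rv R n * rv R n => p.2 i : R).
  exact: (measurableT_comp (measurable_coord i) measurable_snd).
have mf1 : measurable_fun setT f1.
  apply: emeasurable_funM => //; apply/measurable_EFinP; apply: measurable_funM.
    apply: (measurableT_comp (@measurable_gauss_n R n var) (g := fun p : rv R n * rv R n =>
      (fun i => p.2 i + h p.1 i) : rv R n)).
    by apply: measurable_rvP => i; exact: measurable_funD.
  exact: (measurableT_comp (@measurable_gauss_nV R n N N0) measurable_snd).
have mf2 : measurable_fun setT f2.
  apply: (measurableT_comp mF (g := fun p : rv R n * rv R n =>
      (p.1, (fun i => p.2 i - h p.1 i) : rv R n))).
  apply/measurable_fun_pair => //.
  by apply: measurable_rvP => i; exact: measurable_funB.
have f10 p : (0 <= f1 p)%E.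
  by apply: mule_ge0 => //; rewrite lee_fin divr_ge0 ?gauss_n_ge0.
have f20 p : (0 <= f2 p)%E by exact: F0.
apply: (etrans (ge0_integral_prodp (gaussP n Q) (gaussP n N) mf1 f10)).
apply: (etrans _ (esym (ge0_integral_prodp (gaussP n Q) (gaussP n var) mf2 f20))).
apply: eq_integral => s _.
exact: (@gaussP_change R n N var (h s) (fun z => F (s, z)) N0 (mF1 s)).
Qed.

(** The ratio compares a conditional density of the state given the output with its true density.
    Integrating over the state first, it has mean 1 for every output, so only the output law
    remains. *)
Lemma prodp_change_fst n (Q var tau : R) (h : rv R n -> rv R n)
    (F : rv R n -> \bar R) : 0 < Q ->
  measurable_fun setT h -> measurable_fun setT F -> (forall p, 0 <= F p)%E ->
  (\int[prodp (gaussP n Q) (gaussP n var)]_p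
     ((gauss_n tau (fun i => p.1 i + h p.2 i)%R / gauss_n Q p.1)%:E * F p.2)
   = \int[gaussP n var]_y F y)%E.
Proof.
move=> Q0 mh mF F0.
rewrite /prodp fubini_tonelli2/= /fubini_G/=.
- apply: eq_integral => y _.
  rewrite (@gaussP_change R n Q tau (h y) (cst (F y)))//=.
  rewrite integral_cst//; transitivity (F y * 1)%E; last by rewrite mule1.
  congr (_ * _)%E; exact: probability_setT.
- apply: emeasurable_funM; last exact: (measurableT_comp mF measurable_snd).
  apply/measurable_EFinP; apply: measurable_funM.
    apply: (measurableT_comp (@measurable_gauss_n R n tau) (g := fun p : rv R n * rv R n =>
      (fun i => p.1 i + h p.2 i) : rv R n)).
    apply: measurable_rvP => i /=; apply: measurable_funD.
      exact: (measurableT_comp (measurable_coord i) measurable_fst).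
    exact: (measurableT_comp (measurable_coord i) (measurableT_comp mh measurable_snd)).
  exact: (measurableT_comp (@measurable_gauss_nV R n Q Q0) measurable_fst).
- by move=> p; rewrite mule_ge0// lee_fin divr_ge0 ?gauss_n_ge0.
Qed.

End gaussian_change.

Lemma sum_pair (V : nmodType) (I J : finType) (F : I * J -> V) :
  \sum_p F p = \sum_i \sum_j F (i, j).
Proof. by rewrite pair_bigA; apply: eq_bigr => -[]. Qed.

(** * The converse bounds for a fixed code *)

Section code_converse.
Variables (R : realType) (n Mc M1 : nat) (P1 P2 Q N : R) (C : Defs.code R n Mc M1).
Hypotheses (Q0 : 0 < Q) (N0 : 0 < N) (Cok : code_ok P1 P2 C).

Local Notation W := ('I_Mc * 'I_M1)%type.
Local Notation Om := (rv R n * rv R n)%type.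

Let P : probability Om R := prodp (gaussP n Q) (gaussP n N).
Let X1 (w : W) i : R := enc1 C w.1 w.2 i.
Let X2 wc i (p : Om) : R := enc2 C wc p.1 i.
Let Sf i (p : Om) : R := p.1 i.
Let Zf i (p : Om) : R := p.2 i.

Lemma measurable_enc2 wc : measurable_fun setT (enc2 C wc : rv R n -> rv R n).
Proof.
case: Cok => _ [_ [h _]] _ B mB; rewrite setTI; exact: h.
Qed.

Lemma measurable_X2 wc i : measurable_fun setT (X2 wc i).
Proof.
exact: (measurableT_comp (measurable_coord i)
  (measurableT_comp (measurable_enc2 wc) measurable_fst)).
Qed.

Lemma measurable_Sf i : measurable_fun setT (Sf i).
Proof. exact: (measurableT_comp (measurable_coord i) measurable_fst). Qed.

Lemma measurable_Zf i : measurable_fun setT (Zf i).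
Proof. exact: (measurableT_comp (measurable_coord i) measurable_snd). Qed.

Lemma gaussP_intgb_sqr (var : R) i : 0 < var ->
  intgb (gaussP n var) (fun v => v i ^+ 2).
Proof.
move=> var0; have [iS _] := gaussP_intgb_sumsq n var0.
apply: (le_intgb _ _ iS); first exact: (measurable_funX 2 (measurable_coord i)).
move=> v; rewrite ger0_norm ?sqr_ge0// (bigD1 i)//= lerDl.
by apply: sumr_ge0 => j _; exact: sqr_ge0.
Qed.

Lemma L2_Sf i : L2 P (Sf i).
Proof.
split; first exact: measurable_Sf.
exact: (prodp_fst (gaussP n N) (gaussP_intgb_sqr i Q0)).1.
Qed.

Lemma L2_Zf i : L2 P (Zf i).
Proof.
split; first exact: measurable_Zf.
exact: (prodp_snd (gaussP n Q) (gaussP_intgb_sqr i N0)).1.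
Qed.

Lemma L2_X2 wc i : L2 P (X2 wc i).
Proof.
split; first exact: measurable_X2.
apply: (le_intgb _ _ (intgb_cst P (n%:R * P2))).
  exact: (measurable_funX 2 (measurable_X2 wc i)).
move=> p; rewrite ger0_norm ?sqr_ge0//.
case: Cok => _ [/(_ wc p.1) h _]; apply: le_trans h.
by rewrite (bigD1 i)//= lerDl; apply: sumr_ge0 => j _; exact: sqr_ge0.
Qed.

Lemma Ex_Sf i : Ex P (Sf i) = 0.
Proof.
have [i1 e1] := gaussP_intgb_coord i Q0.
by rewrite -[RHS]e1; exact: (prodp_fst (gaussP n N) i1).2.
Qed.

Lemma Ex_Zf i : Ex P (Zf i) = 0.
Proof.
have [i1 e1] := gaussP_intgb_coord i N0.
by rewrite -[RHS]e1; exact: (prodp_snd (gaussP n Q) i1).2.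
Qed.

Lemma ip_X2_Zf wc i : ip P (X2 wc i) (Zf i) = 0.
Proof.
have [i1 e1] := gaussP_intgb_coord i N0.
apply: (@ip_prodp0 _ _ _ _ _ (gaussP n Q) (gaussP n N)
  (fun s => enc2 C wc s i) (fun z => z i)) => //.
exact: (L2_mul (L2_X2 wc i) (L2_Zf i)).
Qed.

Lemma ip_Sf_Zf i : ip P (Sf i) (Zf i) = 0.
Proof.
have [i1 e1] := gaussP_intgb_coord i N0.
apply: (@ip_prodp0 _ _ _ _ _ (gaussP n Q) (gaussP n N)
  (fun s => s i) (fun z => z i)) => //.
exact: (L2_mul (L2_Sf i) (L2_Zf i)).
Qed.

Lemma sum_ip_Sf : \sum_i ip P (Sf i) (Sf i) = n%:R * Q.
Proof.
have [i1 e1] := gaussP_intgb_sumsq n Q0.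
rewrite -[RHS]e1 -[RHS](prodp_fst (gaussP n N) i1).2 -/P Ex_sum; last first.
  by move=> i; exact: (L2_Sf i).2.
by apply: eq_bigr => i _; apply: eq_Ex => p; rewrite expr2.
Qed.

Lemma sum_ip_Zf : \sum_i ip P (Zf i) (Zf i) = n%:R * N.
Proof.
have [i1 e1] := gaussP_intgb_sumsq n N0.
rewrite -[RHS]e1 -[RHS](prodp_snd (gaussP n Q) i1).2 -/P Ex_sum; last first.
  by move=> i; exact: (L2_Zf i).2.
by apply: eq_bigr => i _; apply: eq_Ex => p; rewrite expr2.
Qed.

(** These second moments are totals over messages and times; division by [Mr * n%:R] waits until
    [code_bounds]. The sequence [x] is a parameter because [X1], its conditional mean and the
    deviation from that mean all take its place. *)
Definition sumsq (x : W -> 'I_n -> R) : R := \sum_w \sum_i x w i ^+ 2.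
Definition power2 : R := \sum_(w : W) \sum_i ip P (X2 w.1 i) (X2 w.1 i).
Definition cross12 (x : W -> 'I_n -> R) : R := \sum_w \sum_i x w i * Ex P (X2 w.1 i).
Definition cross2s : R := \sum_(w : W) \sum_i ip P (X2 w.1 i) (Sf i).
Let Mr : R := (Mc * M1)%:R.

(** The Gram form of [x], [X2], [S], [Z], with the two cross terms that can be nonzero: [x] is
    constant given the message while [S] and [Z] are centred, and [Z] is independent of [X2] and
    [S]. *)
Definition gram (x : W -> 'I_n -> R) (k1 k2 k3 k4 : R) : R :=
  k1 ^+ 2 * sumsq x + k2 ^+ 2 * power2 + k3 ^+ 2 * (Mr * (n%:R * Q))
  + k4 ^+ 2 * (Mr * (n%:R * N)) + 2 * k1 * k2 * cross12 x + 2 * k2 * k3 * cross2s.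

Definition quad (x : W -> 'I_n -> R) (k1 k2 k3 k4 : R) (w : W) (p : Om) : R :=
  \sum_i (k1 * x w i + k2 * X2 w.1 i p + k3 * Sf i p + k4 * Zf i p) ^+ 2.

Lemma intgb_quad x k1 k2 k3 k4 w : intgb P (quad x k1 k2 k3 k4 w).
Proof.
apply: intgb_sum => i.
have := (@sqr_comb4 _ _ _ P k1 k2 k3 k4 (fun=> x w i) (X2 w.1 i) (Sf i) (Zf i)
  (L2_cst _ _) (L2_X2 _ _) (L2_Sf _) (L2_Zf _)).1.
by case.
Qed.

Lemma sum_Ex_quad x k1 k2 k3 k4 :
  \sum_w Ex P (quad x k1 k2 k3 k4 w) = gram x k1 k2 k3 k4.
Proof.
transitivity (\sum_(w : W) \sum_i
   (k1 ^+ 2 * x w i ^+ 2 + k2 ^+ 2 * ip P (X2 w.1 i) (X2 w.1 i)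
    + k3 ^+ 2 * ip P (Sf i) (Sf i) + k4 ^+ 2 * ip P (Zf i) (Zf i)
    + 2 * k1 * k2 * (x w i * Ex P (X2 w.1 i))
    + 2 * k2 * k3 * ip P (X2 w.1 i) (Sf i))).
  apply: eq_bigr => w _; rewrite Ex_sum; last first.
    move=> i; have := (@sqr_comb4 _ _ _ P k1 k2 k3 k4 (fun=> x w i) (X2 w.1 i)
      (Sf i) (Zf i) (L2_cst _ _) (L2_X2 _ _) (L2_Sf _) (L2_Zf _)).1.
    by case.
  apply: eq_bigr => i _.
  rewrite (@sqr_comb4 _ _ _ P k1 k2 k3 k4 (fun=> x w i) (X2 w.1 i)
      (Sf i) (Zf i) (L2_cst _ _) (L2_X2 _ _) (L2_Sf _) (L2_Zf _)).2.
  rewrite !ip_cst; [|exact: L2_Zf|exact: L2_Sf|exact: L2_X2|exact: L2_cst].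
  rewrite Ex_cst Ex_Sf Ex_Zf ip_X2_Zf ip_Sf_Zf expr2; ring.
under eq_bigr => w _ do rewrite !big_split /= -!mulr_sumr sum_ip_Sf sum_ip_Zf.
rewrite !big_split /= -!mulr_sumr /gram.
rewrite !sumr_const card_prod !card_ord -[Q *+ _]mulr_natl -[N *+ _]mulr_natl.
by rewrite -/Mr /sumsq /power2 /cross12 /cross2s; ring.
Qed.

Definition Yf (w : W) (p : Om) : rv R n :=
  fun i => X1 w i + X2 w.1 i p + Sf i p + Zf i p.
Definition okset (w : W) : set Om := [set p | dec C (Yf w p) = w].

Lemma measurable_Yf w : measurable_fun setT (Yf w).
Proof.
apply: measurable_rvP => i; apply: measurable_funD; last exact: measurable_Zf.
apply: measurable_funD; last exact: measurable_Sf.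
by apply: measurable_funD; [exact: measurable_cst|exact: measurable_X2].
Qed.

Lemma measurable_dec w : measurable [set y : rv R n | dec C y = w].
Proof. by case: Cok => _ [_ [_ h]]; exact: h. Qed.

Lemma measurable_okset w : measurable (okset w).
Proof.
have := measurable_Yf w measurableT (measurable_dec w); rewrite setTI.
exact.
Qed.

Lemma err_msgE wc w1 : err_msg Q N C wc w1 = P (~` okset (wc, w1)).
Proof.
pose f (p : Om) : \bar R := (\1_(~` okset (wc, w1)) p : R)%:E.
have mC : measurable (~` okset (wc, w1)) by apply: measurableC; exact: measurable_okset.
have mf : measurable_fun setT f by apply/measurable_EFinP; exact: measurable_indic.
have f0 p : (0 <= f p)%E by rewrite lee_fin.
transitivity (\int[gaussP n Q]_s \int[gaussP n N]_z f (s, z))%E; last first.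
  apply: (etrans (esym (ge0_integral_prodp (gaussP n Q) (gaussP n N) mf f0))).
  by rewrite integral_indic// setIT.
rewrite -GamE; last 2 first.
- exact: (measurable_fun_fubini_tonelli_F f mf f0).
- by move=> s; exact: integral_ge0.
apply: eq_iint => s; congr (_ * _)%E; rewrite -GamE//; last first.
  by apply: (measurableT_comp mf); exact: pair1_measurable.
apply: eq_iint => z; congr (_ * _)%E; rewrite /f indicE; congr ((nat_of_bool _)%:R%:E).
apply/idP/idP => [/eqP h|].
  by rewrite mem_set.
by rewrite inE => h; apply/eqP.
Qed.

Lemma prob_setC_okset w : fine (P (~` okset w)) = 1 - fine (P (okset w)).
Proof.
have mA := measurable_okset w.
rewrite -!Ex_indic//; last exact: measurableC.
have iA := intgb_indic P mA.
have := ExD iA (intgb_indic P (measurableC mA)).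
rewrite (_ : (fun x => _ + _) = fun=> 1); last first.
  by apply/funext => p; rewrite !indicE in_setC; case: (_ \in _); rewrite ?addr0 ?add0r.
by rewrite Ex_cst => ->; rewrite addrC addKr.
Qed.

Lemma err_probE : (0 < Mc)%N -> (0 < M1)%N ->
  err_prob Q N C = (1 - (\sum_w fine (P (okset w))) / Mr)%:E.
Proof.
move=> Mc0 M10.
have Mr0 : Mr != 0 by rewrite pnatr_eq0 -lt0n muln_gt0 Mc0.
rewrite /err_prob pair_big /= -/Mr.
transitivity ((\sum_(w : W) (1 - fine (P (okset w)))%:E) * (Mr^-1)%:E)%E.
  congr (_ * _)%E; apply: eq_bigr => -[wc w1] _ /=.
  rewrite err_msgE -prob_setC_okset fineK//.
  by apply: fin_num_measure; apply: measurableC; exact: measurable_okset.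
rewrite sumEFin -EFinM; congr (_%:E).
rewrite sumrB sumr_const card_prod !card_ord -/Mr.
by rewrite -/P mulrBl divff.
Qed.

(* The reference measure for the bound on [R_1] draws [Y] around the mean of
   [X_1] given the common message, independently of [W_1]. *)
Definition cmean (w : W) i : R := (\sum_w1 X1 (w.1, w1) i) / M1%:R.
Definition dev (w : W) i : R := X1 w i - cmean w i.

Lemma individual_converse (sig : R) : (0 < M1)%N -> 0 < sig ->
  ln M1%:R * \sum_w fine (P (okset w)) <=
  Mr * (n%:R / 2 * ln (sig / N))
  + ((sumsq dev + Mr * (n%:R * N)) / (2 * sig) - Mr * n%:R / 2) + Mr.
Proof.
move=> M10 sig0.
have M1r : 0 < M1%:R :> R by rewrite ltr0n.
(* [expR (- L)] is the density of the law under which [Z + dev] is centred Gaussian of variance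
   [sig]; the state keeps its law. *)
pose L (w : W) (p : Om) : R := n%:R / 2 * ln (sig / N) +
  ((2 * sig)^-1 * quad dev 1 0 0 1 w p + (- (2 * N)^-1) * quad dev 0 0 0 1 w p).
have iL w : intgb P (L w).
  apply: intgbD; first exact: intgb_cst.
  by apply: intgbD; apply: intgbZ; exact: intgb_quad.
have EL w : Ex P (L w) = n%:R / 2 * ln (sig / N) +
  ((2 * sig)^-1 * Ex P (quad dev 1 0 0 1 w)
   + (- (2 * N)^-1) * Ex P (quad dev 0 0 0 1 w)).
  rewrite ExD; [|exact: intgb_cst|by apply: intgbD; apply: intgbZ; exact: intgb_quad].
  rewrite Ex_cst ExD; try (by apply: intgbZ; exact: intgb_quad).
  by rewrite !ExZ; try exact: intgb_quad.
pose B (w : W) : set Om := [set p | okset w (p.1, fun i => p.2 i - dev w i)].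
pose P' : probability Om R := prodp (gaussP n Q) (gaussP n sig).
have mB w : measurable (B w).
  have mt : measurable_fun setT
      (fun p : Om => (p.1, (fun i => p.2 i - dev w i) : rv R n)).
    apply/measurable_fun_pair => //; apply: measurable_rvP => i.
    by apply: measurable_funB; [exact: measurable_Zf|exact: measurable_cst].
  by have := mt measurableT _ (measurable_okset w); rewrite setTI.
have expL w p : expR (- L w p) =
    gauss_n sig (fun i => p.2 i + dev w i) / gauss_n N p.2.
  rewrite !gauss_nE// -expRN -expRD; congr expR; rewrite /L /quad.
  have -> : \sum_i (1 * dev w i + 0 * X2 w.1 i p + 0 * Sf i p + 1 * Zf i p) ^+ 2
      = \sum_i (p.2 i + dev w i) ^+ 2.
    by apply: eq_bigr => i _; rewrite /Zf; ring.
  have -> : \sum_i (0 * dev w i + 0 * X2 w.1 i p + 0 * Sf i p + 1 * Zf i p) ^+ 2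
      = \sum_i p.2 i ^+ 2.
    by apply: eq_bigr => i _; rewrite /Zf; ring.
  have p0 : 0 < 2 * pi :> R by rewrite mulr_gt0 ?pi_gt0.
  rewrite ln_div ?posrE// (lnM (x := 2 * pi)) ?posrE// (lnM (x := 2 * pi)) ?posrE//.
  by ring.
have intL w (A : set Om) : measurable A ->
    (\int[P]_p (expR (- L w p) * \1_A p)%:E =
     \int[P']_p (\1_A (p.1, (fun i => p.2 i - dev w i)%R))%:E)%E.
  move=> mA.
  transitivity (\int[P]_p ((gauss_n sig (fun i => p.2 i + dev w i)%R
      / gauss_n N p.2)%:E * (\1_A p)%:E))%E.
    by apply: eq_integral => p _; rewrite expL EFinM.
  apply: (@prodp_change R n Q N sig (fun=> dev w) (fun p => (\1_A p)%:E)) => //.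
  by apply/measurable_EFinP; exact: measurable_indic.
have intL1 w : (\int[P]_p (expR (- L w p))%:E = 1)%E.
  apply: (etrans _ (integral_prob_cst P' 1)).
  transitivity (\int[P]_p (expR (- L w p) * \1_setT p)%:E)%E.
    by apply: eq_integral => p _; rewrite indicT mulr1.
  apply: (etrans (intL w setT measurableT)).
  by apply: eq_integral => p _; rewrite indicT.
have intLB w : (\int[P]_p (expR (- L w p) * \1_(okset w) p)%:E =
    (fine (P' (B w)))%:E)%E.
  apply: (etrans (intL w _ (measurable_okset w))).
  rewrite fineK; last exact: fin_num_measure.
  by apply: (etrans (integral_indic P' measurableT (mB w))); rewrite setIT.
(* Under the reference law the deviation cancels and the output depends on the message only through
   [wc]. For fixed [wc] the events [B] are therefore disjoint over [w1], and each common message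
   contributes at most 1. *)
have sumB : \sum_w fine (P' (B w)) <= Mc%:R.
  rewrite sum_pair.
  have -> : Mc%:R = \sum_(wc < Mc) 1 :> R by rewrite sumr_const card_ord.
  apply: ler_sum => wc _; apply: sum_disjoint_le1 => [w1|w1 w1' p]; first exact: mB.
  rewrite /B /okset /=.
  have YE w : Yf (wc, w) (p.1, fun i => p.2 i - dev (wc, w) i) =
      (fun i => cmean (wc, w1) i + enc2 C wc p.1 i + p.1 i + p.2 i).
    by apply/funext => i; rewrite /Yf /X2 /Sf /Zf /dev /cmean /=; ring.
  by rewrite !YE => -> [].
(* With [t = ln M1%:R] the penalty is [M1] times at most [Mc], that is [Mr]: the constant 1 after
   division by the number of message pairs. *)
have : \sum_w ln M1%:R * fine (P (okset w)) <=
    \sum_w (Ex P (L w) + expR (ln M1%:R) * fine (P' (B w))).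
  apply: ler_sum => w _; apply: change_of_measure_converse => //.
  - exact: measurable_okset.
  - by rewrite intL1.
  - by rewrite intLB.
rewrite -mulr_sumr big_split /= -mulr_sumr lnK ?posrE//.
under [X in _ <= X + _]eq_bigr do rewrite EL.
rewrite !big_split /= -!mulr_sumr !sum_Ex_quad sumr_const card_prod !card_ord.
rewrite -[ln _ *+ _]mulr_natl [_ / 2 * (_ * _)]mulrCA => h.
have h2 : M1%:R * \sum_w fine (P' (B w)) <= Mr.
  by rewrite /Mr natrM mulrC ler_pM2r.
have -> : (sumsq dev + Mr * (n%:R * N)) / (2 * sig) - Mr * n%:R / 2 =
    (2 * sig)^-1 * gram dev 1 0 0 1 - (2 * N)^-1 * gram dev 0 0 0 1.
  by rewrite /gram -/Mr; field; rewrite !gt_eqF.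
by apply: (le_trans h); rewrite mulNr; exact: lerD.
Qed.

(** The free parameters describe the reference law: [Y] has variance [sig], and given [X1] and [Y]
    the state has variance [tau] around [lam * Y - eta * X1]. Substituting the channel into the
    residual [S + eta * X1 - lam * Y] gives the coefficients of the second [gram] term. *)
Lemma sum_converse (sig tau lam eta : R) : (0 < Mc)%N -> (0 < M1)%N ->
  0 < sig -> 0 < tau ->
  ln Mr * \sum_w fine (P (okset w)) <=
  Mr * (n%:R / 2 * ln (sig * tau / (N * Q)))
  + (gram X1 1 1 1 1 / (2 * sig)
     + gram X1 (eta - lam) (- lam) (1 - lam) (- lam) / (2 * tau) - Mr * n%:R) + Mr.
Proof.
move=> Mc0 M10 sig0 tau0.
have Mr0 : 0 < Mr by rewrite ltr0n muln_gt0 Mc0.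
pose q1 := quad X1 1 1 1 1.
pose q2 := quad X1 (eta - lam) (- lam) (1 - lam) (- lam).
pose q3 := quad X1 0 0 0 1.
pose q4 := quad X1 0 0 1 0.
pose L (w : W) (p : Om) : R := n%:R / 2 * ln (sig * tau / (N * Q)) +
  (((2 * sig)^-1 * q1 w p + (2 * tau)^-1 * q2 w p) +
   ((- (2 * N)^-1) * q3 w p + (- (2 * Q)^-1) * q4 w p)).
have iZ a k1 k2 k3 k4 w : intgb P (fun p => a * quad X1 k1 k2 k3 k4 w p).
  by apply: intgbZ; exact: intgb_quad.
have iL w : intgb P (L w).
  apply: intgbD; first exact: intgb_cst.
  by apply: intgbD; apply: intgbD; exact: iZ.
have EL w : Ex P (L w) = n%:R / 2 * ln (sig * tau / (N * Q)) +
  (((2 * sig)^-1 * Ex P (q1 w) + (2 * tau)^-1 * Ex P (q2 w)) +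
   ((- (2 * N)^-1) * Ex P (q3 w) + (- (2 * Q)^-1) * Ex P (q4 w))).
  rewrite ExD; [|exact: intgb_cst|by apply: intgbD; apply: intgbD; exact: iZ].
  rewrite Ex_cst ExD; try (by apply: intgbD; exact: iZ).
  rewrite !ExD; try exact: iZ.
  by rewrite !ExZ; try exact: intgb_quad.
pose G : probability (rv R n) R := gaussP n sig.
pose P' : probability Om R := prodp (gaussP n Q) (gaussP n sig).
pose h w (s : rv R n) : rv R n := fun i => X1 w i + enc2 C w.1 s i + s i.
pose h' (w : W) (y : rv R n) : rv R n := fun i => eta * X1 w i - lam * y i.
have mh w : measurable_fun setT (h w).
  apply: measurable_rvP => i; apply: measurable_funD; last exact: measurable_coord.
  apply: measurable_funD; first exact: measurable_cst.
  exact: (measurableT_comp (measurable_coord i) (measurable_enc2 w.1)).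
have mh' w : measurable_fun setT (h' w).
  apply: measurable_rvP => i; apply: measurable_funB; first exact: measurable_cst.
  by apply: measurable_funM; [exact: measurable_cst|exact: measurable_coord].
have mA (w : W) (A : set (rv R n)) : measurable A ->
    measurable_fun setT (fun p : Om => (\1_A (Yf w p) : R)).
  move=> mA; exact: (measurableT_comp (@measurable_indic _ _ R setT A mA) (measurable_Yf w)).
pose F (w : W) (A : set (rv R n)) (p : Om) : \bar R :=
  ((gauss_n tau (fun i => p.1 i + h' w (Yf w p) i)%R / gauss_n Q p.1)%:E
   * (\1_A (Yf w p))%:E)%E.
have mF w A : measurable A -> measurable_fun setT (F w A).
  move=> mA'; apply: emeasurable_funM; last by apply/measurable_EFinP; exact: mA.
  apply/measurable_EFinP; apply: measurable_funM.
    apply: (measurableT_comp (@measurable_gauss_n R n tau) (g := fun p : Om =>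
      (fun i => p.1 i + h' w (Yf w p) i) : rv R n)).
    apply: measurable_rvP => i; apply: measurable_funD; first exact: measurable_Sf.
    exact: (measurableT_comp (measurable_coord i)
      (measurableT_comp (mh' w) (measurable_Yf w))).
  exact: (measurableT_comp (@measurable_gauss_nV R n Q Q0) measurable_fst).
have F0 w A p : (0 <= F w A p)%E.
  by apply: mule_ge0; rewrite lee_fin ?divr_ge0 ?gauss_n_ge0.
have expL w p : expR (- L w p) =
    gauss_n sig (fun i => p.2 i + h w p.1 i) / gauss_n N p.2 *
    (gauss_n tau (fun i => p.1 i + h' w (Yf w p) i) / gauss_n Q p.1).
  rewrite !gauss_nE// -!expRN -!expRD; congr expR; rewrite /L /q1 /q2 /q3 /q4 /quad.
  have -> : \sum_i (1 * X1 w i + 1 * X2 w.1 i p + 1 * Sf i p + 1 * Zf i p) ^+ 2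
      = \sum_i (p.2 i + h w p.1 i) ^+ 2.
    by apply: eq_bigr => i _; rewrite /Zf /Sf /h /X2; ring.
  have -> : \sum_i ((eta - lam) * X1 w i + (- lam) * X2 w.1 i p
      + (1 - lam) * Sf i p + (- lam) * Zf i p) ^+ 2
      = \sum_i (p.1 i + h' w (Yf w p) i) ^+ 2.
    by apply: eq_bigr => i _; rewrite /h' /Yf /Zf /Sf; ring.
  have -> : \sum_i (0 * X1 w i + 0 * X2 w.1 i p + 0 * Sf i p + 1 * Zf i p) ^+ 2
      = \sum_i p.2 i ^+ 2.
    by apply: eq_bigr => i _; rewrite /Zf; ring.
  have -> : \sum_i (0 * X1 w i + 0 * X2 w.1 i p + 1 * Sf i p + 0 * Zf i p) ^+ 2
      = \sum_i p.1 i ^+ 2.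
    by apply: eq_bigr => i _; rewrite /Sf; ring.
  have p0 : 0 < 2 * pi :> R by rewrite mulr_gt0 ?pi_gt0.
  have lE a : 0 < a -> ln (2 * pi * a) = ln (2 * pi) + ln a :> R.
    by move=> a0; rewrite lnM ?posrE.
  rewrite ln_div ?posrE ?mulr_gt0// !lE//.
  rewrite [ln (sig * tau)]lnM ?posrE// [ln (N * Q)]lnM ?posrE//.
  by ring.
(* Two changes of law in turn: shifting the noise by [h] makes [Y] itself the second coordinate,
   Gaussian and independent of the message; the state factor then integrates to 1. *)
have intL w (A : set (rv R n)) : measurable A ->
    (\int[P]_p (expR (- L w p) * \1_A (Yf w p))%:E = \int[G]_y (\1_A y)%:E)%E.
  move=> mA'.
  transitivity (\int[P]_p ((gauss_n sig (fun i => p.2 i + h w p.1 i)%R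
      / gauss_n N p.2)%:E * F w A p))%E.
    apply: eq_integral => p _; rewrite expL -[X in X%:E]mulrA EFinM.
    by congr (_ * _)%E; exact: EFinM.
  apply: (etrans (@prodp_change R n Q N sig (h w) (F w A) N0 (mh w) (mF w A mA') (F0 w A))).
  have m1 : measurable_fun setT (fun y : rv R n => (\1_A y : R)%:E).
    by apply/measurable_EFinP; exact: measurable_indic.
  have m10 y : (0 <= (\1_A y : R)%:E)%E by rewrite lee_fin.
  apply: (etrans _ (@prodp_change_fst R n Q sig tau (h' w) (fun y => (\1_A y)%:E)
    Q0 (mh' w) m1 m10)).
  apply: eq_integral => p _; rewrite /F /=.
  have -> // : Yf w (p.1, fun i => p.2 i - h w p.1 i) = p.2.
  by apply/funext => i; rewrite /Yf /h /X2 /Sf /Zf /=; ring.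
have intL1 w : (\int[P]_p (expR (- L w p))%:E = 1)%E.
  apply: (etrans _ (integral_prob_cst G 1)).
  transitivity (\int[P]_p (expR (- L w p) * \1_setT (Yf w p))%:E)%E.
    by apply: eq_integral => p _; rewrite indicT mulr1.
  apply: (etrans (intL w setT measurableT)).
  by apply: eq_integral => p _; rewrite indicT.
pose D w : set (rv R n) := [set y | dec C y = w].
have intLB w : (\int[P]_p (expR (- L w p) * \1_(okset w) p)%:E =
    (fine (G (D w)))%:E)%E.
  transitivity (\int[P]_p (expR (- L w p) * \1_(D w) (Yf w p))%:E)%E.
    by apply: eq_integral => p _.
  apply: (etrans (intL w _ (measurable_dec w))).
  rewrite fineK; last by apply: fin_num_measure; exact: measurable_dec.
  by apply: (etrans (integral_indic G measurableT (measurable_dec w))); rewrite setIT.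
(* One output law [G] serves all message pairs, so the total is 1 rather than [Mc], which allows
   [t = ln Mr]. *)
have sumD : \sum_w fine (G (D w)) <= 1.
  by apply: sum_disjoint_le1 => [w|w w' y]; [exact: measurable_dec|rewrite /D /= => -> ->].
have : \sum_w ln Mr * fine (P (okset w)) <=
    \sum_w (Ex P (L w) + expR (ln Mr) * fine (G (D w))).
  apply: ler_sum => w _; apply: change_of_measure_converse => //.
  - exact: measurable_okset.
  - by rewrite intL1.
  - by rewrite intLB.
rewrite -mulr_sumr big_split /= -mulr_sumr lnK ?posrE//.
under [X in _ <= X + _]eq_bigr do rewrite EL.
rewrite !big_split /= -!mulr_sumr !sum_Ex_quad sumr_const card_prod !card_ord.
rewrite -[ln _ *+ _]mulr_natl [_ / 2 * (_ * _)]mulrCA => H.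
have H2 : Mr * \sum_w fine (G (D w)) <= Mr by rewrite ger_pMr.
have -> : gram X1 1 1 1 1 / (2 * sig)
     + gram X1 (eta - lam) (- lam) (1 - lam) (- lam) / (2 * tau) - Mr * n%:R =
  (2 * sig)^-1 * gram X1 1 1 1 1 +
  (2 * tau)^-1 * gram X1 (eta - lam) (- lam) (1 - lam) (- lam) +
  (- (2 * N)^-1 * gram X1 0 0 0 1 + - (2 * Q)^-1 * gram X1 0 0 1 0).
  by rewrite [gram X1 0 0 0 1]/gram [gram X1 0 0 1 0]/gram -/Mr; field; rewrite !gt_eqF.
by apply: (le_trans H); exact: lerD.
Qed.

Lemma sumsq_ge0 x : 0 <= sumsq x.
Proof. by apply: sumr_ge0 => w _; apply: sumr_ge0 => i _; exact: sqr_ge0. Qed.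

Lemma sumsq_X1_le : sumsq X1 <= Mr * (n%:R * P1).
Proof.
rewrite /sumsq (@le_trans _ _ (\sum_(w : W) n%:R * P1))//.
  by apply: ler_sum => w _; case: Cok => h _; exact: h.
by rewrite sumr_const card_prod !card_ord -[leLHS]mulr_natl.
Qed.

Lemma power2_le : power2 <= Mr * (n%:R * P2).
Proof.
rewrite /power2 (@le_trans _ _ (\sum_(w : W) n%:R * P2))//.
  apply: ler_sum => w _; rewrite -Ex_sum; last first.
    by move=> i; exact: (L2_mul (L2_X2 _ _) (L2_X2 _ _)).
  rewrite -[leRHS](Ex_cst P); apply: Ex_le; [|exact: intgb_cst|].
    by apply: intgb_sum => i; exact: (L2_mul (L2_X2 _ _) (L2_X2 _ _)).
  move=> p; case: Cok => _ [/(_ w.1 p.1) h _]; apply: le_trans h.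
  by apply: ler_sum => i _; rewrite expr2.
by rewrite sumr_const card_prod !card_ord -[leLHS]mulr_natl.
Qed.

(** Averaging over [w1] is the orthogonal projection onto functions of the common message. With the
    mean of [X2] as [f], this is where the informed encoder's ignorance of [W_1] enters. *)
Lemma sum_cmean (f : 'I_Mc -> 'I_n -> R) : (0 < M1)%N ->
  \sum_w \sum_i X1 w i * f w.1 i = \sum_w \sum_i cmean w i * f w.1 i.
Proof.
move=> M10; rewrite !sum_pair; apply: eq_bigr => wc _.
rewrite exchange_big [RHS]exchange_big; apply: eq_bigr => i _ /=.
rewrite /cmean /= sumr_const card_ord -mulr_suml -[_ *+ M1]mulr_natr mulrAC.
by rewrite divfK// pnatr_eq0 -lt0n.
Qed.

Lemma cross12_cmean : (0 < M1)%N -> cross12 cmean = cross12 X1.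
Proof. by move=> M10; rewrite /cross12 (sum_cmean (fun wc i => Ex P (X2 wc i))). Qed.

(** Pythagoras for the projection [cmean]. *)
Lemma sumsq_dev : (0 < M1)%N -> sumsq dev = sumsq X1 - sumsq cmean.
Proof.
move=> M10; have h := sum_cmean (fun wc i => (\sum_w1 X1 (wc, w1) i) / M1%:R) M10.
have -> : sumsq dev = sumsq X1 - 2 * (\sum_w \sum_i X1 w i * cmean w i) + sumsq cmean.
  rewrite /sumsq mulr_sumr -sumrB -big_split; apply: eq_bigr => w _ /=.
  rewrite mulr_sumr -sumrB -big_split; apply: eq_bigr => i _ /=.
  by rewrite /dev; ring.
have -> : \sum_w \sum_i X1 w i * cmean w i = sumsq cmean.
  rewrite -[LHS]/(\sum_w \sum_i X1 w i * ((\sum_w1 X1 (w.1, w1) i) / M1%:R)) h /sumsq.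
  by apply: eq_bigr => w _; apply: eq_bigr => i _; rewrite expr2.
by ring.
Qed.

Lemma gram_ge0 x k1 k2 k3 k4 : 0 <= gram x k1 k2 k3 k4.
Proof.
rewrite -sum_Ex_quad; apply: sumr_ge0 => w _; rewrite -(Ex_cst P 0).
apply: Ex_le; [exact: intgb_cst|exact: intgb_quad|move=> p].
by apply: sumr_ge0 => i _; exact: sqr_ge0.
Qed.

(** Per-letter averages: [a] and [b] are the powers of [X1] and [X2], [m] that of the conditional
    mean of [X1], and [c], [d] are the correlations of [X2] with [X1] and with [S]. The quadratic
    form carries [m] instead of the larger [a], since [c] is also the correlation of [X2] with the
    conditional mean; this gain ties the two rate bounds together. *)
Lemma code_bounds (e : R) : (0 < n)%N -> (0 < Mc)%N -> (0 < M1)%N ->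
  err_prob Q N C = e%:E ->
  exists a m b c d : R,
  [/\ [/\ 0 <= m, m <= a, a <= P1 & b <= P2],
      (forall s t, 0 <= s ^+ 2 * m + b + t ^+ 2 * Q + 2 * s * c + 2 * t * d),
      e <= 1,
      (1 - e) * ln M1%:R <= n%:R / 2 * ln (1 + (a - m) / N) + 1 &
      forall sig tau lam eta : R, 0 < sig -> 0 < tau ->
      (1 - e) * ln (Mc * M1)%:R <=
      n%:R / 2 * (ln (sig * tau / (N * Q)) + (a + b + Q + N + 2 * c + 2 * d) / sig
        + ((eta - lam) ^+ 2 * a + lam ^+ 2 * b + (1 - lam) ^+ 2 * Q + lam ^+ 2 * N
           - 2 * (eta - lam) * lam * c - 2 * lam * (1 - lam) * d) / tau - 2) + 1].
Proof.
move=> n0 Mc0 M10 He.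
have nr : 0 < n%:R :> R by rewrite ltr0n.
have Mr0 : 0 < Mr by rewrite ltr0n muln_gt0 Mc0.
pose K := Mr * n%:R; have K0 : 0 < K by rewrite mulr_gt0.
have Sg : \sum_w fine (P (okset w)) = (1 - e) * Mr.
  move: He; rewrite err_probE// => -[<-].
  by rewrite opprB addrC subrK divfK ?gt_eqF.
have Sg0 : 0 <= \sum_w fine (P (okset w)).
  by apply: sumr_ge0 => w _; rewrite fine_ge0.
exists (sumsq X1 / K), (sumsq cmean / K), (power2 / K), (cross12 X1 / K), (cross2s / K); split.
- split.
  + by rewrite divr_ge0 ?sumsq_ge0// ltW.
  + by rewrite ler_pM2r ?invr_gt0// -subr_ge0 -sumsq_dev// sumsq_ge0.
  + by rewrite ler_pdivrMr// (le_trans sumsq_X1_le)// /K (mulrC P1) -mulrA.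
  + by rewrite ler_pdivrMr// (le_trans power2_le)// /K (mulrC P2) -mulrA.
- move=> s t; have := gram_ge0 cmean s 1 t 0; rewrite -(pmulr_rge0 _ K0) => h.
  rewrite -(pmulr_rge0 _ K0).
  have -> : K * (s ^+ 2 * (sumsq cmean / K) + power2 / K + t ^+ 2 * Q
      + 2 * s * (cross12 X1 / K) + 2 * t * (cross2s / K)) = gram cmean s 1 t 0.
    rewrite /gram cross12_cmean// !(mulrA Mr) -/K; clearbody K.
    by field; rewrite gt_eqF.
  exact: gram_ge0.
- by move: Sg0; rewrite Sg pmulr_lge0// subr_ge0.
- have dv : 0 <= sumsq dev / K by rewrite divr_ge0 ?sumsq_ge0// ltW.
  rewrite -mulrBl -sumsq_dev//; set v := sumsq dev / K in dv *.
  (* [N + v] is the mean square of [Z + dev]; with it as [sig] the quadratic terms cancel and only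
     the logarithm stays. *)
  have s0 : 0 < N + v by rewrite ltr_wpDr.
  have := individual_converse M10 s0; rewrite Sg => h.
  have vE : sumsq dev = v * (Mr * n%:R) by rewrite /v divfK ?gt_eqF.
  rewrite -(ler_pM2l Mr0).
  have -> : 1 + v / N = (N + v) / N by field; rewrite gt_eqF.
  have -> : Mr * ((1 - e) * ln M1%:R) = ln M1%:R * ((1 - e) * Mr) by ring.
  apply: (le_trans h); rewrite le_eqVlt; apply/orP; left; apply/eqP.
  by rewrite vE; field; rewrite !gt_eqF.
- move=> sig tau lam eta sig0 tau0.
  have := sum_converse lam eta Mc0 M10 sig0 tau0; rewrite Sg => h.
  rewrite -(ler_pM2l Mr0).
  have -> : Mr * ((1 - e) * ln (Mc * M1)%:R) = ln Mr * ((1 - e) * Mr).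
    by rewrite /Mr; ring.
  apply: (le_trans h); rewrite le_eqVlt; apply/orP; left; apply/eqP.
  rewrite /gram -/Mr /K; field.
  by rewrite !pnatr_eq0 -!lt0n n0 Mc0 M10 !gt_eqF.
Qed.

End code_converse.

(** * From second moments to correlation coefficients *)

Section scalar.
Variable R : realType.
Implicit Types a b c d k m s t u w D P Q N : R.

Lemma discriminant_le m D c : 0 <= m ->
  (forall s, 0 <= s ^+ 2 * m + D + 2 * s * c) -> 0 <= D /\ c ^+ 2 <= m * D.
Proof.
move=> m0 H; have D0 : 0 <= D by have := H 0; rewrite expr0n /= !mulr0 !mul0r addr0 add0r.
split=> //; have [mE|mN0] := eqVneq m 0.
  have [->|cN0] := eqVneq c 0; first by rewrite expr0n mE mul0r.
  (* With [m = 0] the form is affine in [s], and at this point its value is -1. *)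
  have := H (- (D + 1) / (2 * c)); rewrite mE mulr0 add0r.
  have -> : 2 * (- (D + 1) / (2 * c)) * c = - (D + 1) by field.
  by rewrite opprD addrA subrr add0r oppr_ge0 ler10.
have m0' : 0 < m by rewrite lt_neqAle eq_sym mN0.
have := H (- c / m); rewrite -(pmulr_rge0 _ m0').
have -> : m * ((- c / m) ^+ 2 * m + D + 2 * (- c / m) * c) = m * D - c ^+ 2.
  by field.
by rewrite subr_ge0.
Qed.

(** Serves to raise the powers to [P1] and [P2] and to fix the signs of the correlations. Growth in
    [w] is hidden, as [w] also sits in a denominator; after expansion it rests on the growth of (w +
    N) / (w + B + N). *)
Lemma dpc_mono (A A' B B' w w' N : R) : 0 < N -> 0 <= w <= w' ->
  0 <= A <= A' -> 0 <= B' <= B ->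
  (1 + A / (w + B + N)) * (1 + w / N) <= (1 + A' / (w' + B' + N)) * (1 + w' / N).
Proof.
move=> N0 /andP[w0 ww] /andP[A0 AA] /andP[B0 BB].
have V1 : 0 < w + B + N by lra.
have V2 : 0 < w' + B' + N by lra.
have E x y z : 0 < x + y + N ->
    (1 + z / (x + y + N)) * (1 + x / N) = ((x + N) + z * ((x + N) / (x + y + N))) / N.
  by move=> h; field; rewrite !gt_eqF.
rewrite !E// ler_pM2r ?invr_gt0//; apply: lerD; first lra.
apply: ler_pM => //; first by rewrite divr_ge0//; lra.
rewrite ler_pdivrMr// mulrAC ler_pdivlMr//.
have : (w + N) * B' <= (w' + N) * B by apply: ler_pM => //; lra.
by nra.
Qed.

(** With rho_2s = [u] and rho_12 = [k * Num.sqrt (1 - u ^+ 2)] this is P2 (1 - rho_12^2 - rho_2s^2);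
    [corr] and [noise] are the numerator and denominator of the fraction in the sum-rate bound. *)
Definition resid (P2 : R) k u : R := P2 * ((1 - k ^+ 2) * (1 - u ^+ 2)).

Definition corr (P1 P2 : R) k u : R :=
  (Num.sqrt P1 + k * Num.sqrt (1 - u ^+ 2) * Num.sqrt P2) ^+ 2.

Definition noise (P2 : R) Q N k u : R :=
  resid P2 k u + (Num.sqrt Q + u * Num.sqrt P2) ^+ 2 + N.

(* Given the second-order statistics of a code, the reference parameters are
   those of the linear MMSE estimate of [S] from [(X_1, Y)]. *)
Lemma gaussian_optimum (P1 P2 : R) Q N a m b c d :
  0 < Q -> 0 < N -> 0 <= m -> m <= a -> a <= P1 -> b <= P2 ->
  (forall s t, 0 <= s ^+ 2 * m + b + t ^+ 2 * Q + 2 * s * c + 2 * t * d) ->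
  exists k u : R, [/\ 0 <= k <= 1, -1 <= u <= 0, a - m <= P1 * (1 - k ^+ 2) &
  exists sig tau lam eta : R, [/\ 0 < sig, 0 < tau,
    a + b + Q + N + 2 * c + 2 * d = sig,
    (eta - lam) ^+ 2 * a + lam ^+ 2 * b + (1 - lam) ^+ 2 * Q + lam ^+ 2 * N
      - 2 * (eta - lam) * lam * c - 2 * lam * (1 - lam) * d = tau &
    sig * tau / (N * Q) <=
    (1 + corr P1 P2 k u / noise P2 Q N k u) * (1 + resid P2 k u / N)]].
Proof.
move=> Q0 N0 m0 ma aP bP H.
have a0 : 0 <= a by exact: le_trans ma.
pose ra := Num.sqrt a; have raE : ra ^+ 2 = a by rewrite sqr_sqrtr.
have ra0 : 0 <= ra by exact: sqrtr_ge0.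
pose q := Num.sqrt Q; have qE : q ^+ 2 = Q by rewrite sqr_sqrtr ?ltW.
have q0 : 0 < q by rewrite sqrtr_gt0.
(* [del] is the component of [X2] along the normalised state, [gam] further on the one along
   normalised [X1]. *)
pose del := d / q; have dE : d = del * q by rewrite divfK ?gt_eqF.
(* The value [t = - del / q] minimises over the state coefficient and leaves the Schur
   complement. *)
have [D0 cD] : 0 <= b - del ^+ 2 /\ c ^+ 2 <= m * (b - del ^+ 2).
  apply: discriminant_le => // s; have := H s (- del / q); rewrite dE -qE.
  have -> : s ^+ 2 * m + b + (- del / q) ^+ 2 * q ^+ 2 + 2 * s * c
      + 2 * (- del / q) * (del * q) = s ^+ 2 * m + (b - del ^+ 2) + 2 * s * c.
    by field; rewrite gt_eqF.
  by [].
(* If [a = 0] then [m = 0] and hence [c = 0], so the default 0 of this division is the right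
   value. *)
pose gam := c / ra.
have cE : c = gam * ra.
  have [ra00|raN0] := eqVneq ra 0; last by rewrite divfK.
  rewrite ra00 mulr0; apply/eqP; rewrite -sqrf_eq0 eq_le sqr_ge0 andbT.
  have m00 : m = 0 by apply/eqP; rewrite eq_le m0 andbT -(_ : a = 0)// -raE ra00 expr0n.
  by rewrite (le_trans cD)// m00 mul0r.
have gD : gam ^+ 2 <= b - del ^+ 2.
  have [ra00|raN0] := eqVneq ra 0; first by rewrite /gam ra00 invr0 mulr0 expr0n.
  have a0' : 0 < a by rewrite -raE exprn_even_gt0.
  rewrite -(ler_pM2r a0') -{1}raE -exprMn -cE mulrC.
  by apply: (le_trans cD); exact: ler_wpM2r.
(* [w] is the power of [X2] orthogonal to [X1] and [S], [V] the variance of [Y] without its [X1]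
   component, and [lam] the regression coefficient of [S] on what remains of [Y]. *)
pose w := b - gam ^+ 2 - del ^+ 2.
have w0 : 0 <= w by rewrite /w; lra.
pose V := w + (q + del) ^+ 2 + N.
have V0 : 0 < V by rewrite /V; have := sqr_ge0 (q + del); lra.
pose lam := q * (del + q) / V.
(* [eta = zet + lam] cancels the [X1] component of [lam * Y], which has size [lam * (ra + gam)]. *)
have [zet zetE] : exists zet, zet * ra = lam * gam.
  have [ra00|raN0] := eqVneq ra 0; last by exists (lam * gam / ra); rewrite divfK.
  by exists 0; rewrite /gam ra00 invr0 !mulr0.
pose P2d := P2 - del ^+ 2.
have P2d0 : 0 <= P2d by rewrite /P2d; lra.
have P20 : 0 <= P2 by have := sqr_ge0 del; rewrite /P2d in P2d0; lra.
pose sP := Num.sqrt P2; have sPE : sP ^+ 2 = P2 by rewrite sqr_sqrtr.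
have sP0 : 0 <= sP by exact: sqrtr_ge0.
(* Correlations are normalised by the full power [P2] and given their most favourable signs: [u]
   nonpositive, against the state, and [k] nonnegative, along [X1]. In [k] the reference is the
   power left once the state component is removed. *)
pose u := - (`|del| / sP).
have uP : u * sP = - `|del|.
  have [sP00|sPN0] := eqVneq sP 0; last by rewrite mulNr divfK.
  rewrite sP00 mulr0; apply/eqP; rewrite eq_sym oppr_eq0 normr_eq0 -sqrf_eq0.
  rewrite eq_le sqr_ge0 andbT; move: P2d0; rewrite /P2d -sPE sP00 expr0n /=; lra.
have u2 : u ^+ 2 * P2 = del ^+ 2 by rewrite -sPE -exprMn uP sqrrN real_normK ?num_real.
have u01 : -1 <= u <= 0.
  rewrite oppr_le0 divr_ge0// andbT lerNl opprK.
  have [sP00|sPN0] := eqVneq sP 0; first by rewrite sP00 invr0 mulr0.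
  rewrite ler_pdivrMr ?lt_neqAle 1?eq_sym ?sPN0// mul1r.
  rewrite -(@ler_pXn2r _ 2) ?nnegrE// real_normK ?num_real// sPE -subr_ge0.
  exact: P2d0.
pose sD := Num.sqrt P2d; have sDE : sD ^+ 2 = P2d by rewrite sqr_sqrtr.
have sD0 : 0 <= sD by exact: sqrtr_ge0.
have gP : gam ^+ 2 <= P2d by rewrite /P2d; lra.
pose k := `|gam| / sD.
have kD : k * sD = `|gam|.
  have [sD00|sDN0] := eqVneq sD 0; last by rewrite divfK.
  rewrite sD00 mulr0; apply/eqP; rewrite eq_sym normr_eq0 -sqrf_eq0.
  by rewrite eq_le sqr_ge0 andbT (le_trans gP)// -sDE sD00 expr0n.
have k01 : 0 <= k <= 1.
  rewrite divr_ge0//=.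
  have [sD00|sDN0] := eqVneq sD 0; first by rewrite /k sD00 invr0 mulr0.
  rewrite ler_pdivrMr ?lt_neqAle 1?eq_sym ?sDN0// mul1r.
  by rewrite -(@ler_pXn2r _ 2) ?nnegrE// real_normK ?num_real// sDE.
have k2 : k ^+ 2 * P2d = gam ^+ 2 by rewrite -sDE -exprMn kD real_normK ?num_real.
(* Here the form with [m] pays off: k^2 a P2d = c^2 <= m (b - del^2) <= m P2d, which makes this [k]
   admissible in the bound on [R_1]. *)
have k2a : k ^+ 2 * a <= m.
  have [sD00|sDN0] := eqVneq sD 0; first by rewrite /k sD00 invr0 mulr0 expr0n mul0r.
  have P2d0' : 0 < P2d by rewrite -sDE exprn_even_gt0.
  rewrite -(ler_pM2r P2d0') mulrAC k2 -raE -exprMn -cE (le_trans cD)//.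
  by rewrite ler_wpM2l// /P2d; lra.
have k21 : k ^+ 2 <= 1 by case/andP: k01 => k0 k1; rewrite expr_le1.
exists k, u; split=> //.
  apply: (@le_trans _ _ (a * (1 - k ^+ 2))); first lra.
  by rewrite ler_wpM2r ?subr_ge0.
have residE : resid P2 k u = P2d - gam ^+ 2.
  rewrite /resid -k2 /P2d -u2; ring.
have sq1 : Num.sqrt (1 - u ^+ 2) * sP = sD.
  rewrite /sP /sD -sqrtrM; first by congr Num.sqrt; rewrite /P2d -u2; ring.
  by case/andP: u01 => h1 h2; nra.
(* The variance of [Y] and the mean squared error of the estimate of [S], so that both quadratic
   terms of the converse become 1 and cancel its [- 2]. *)
exists ((ra + gam) ^+ 2 + V), (Q * (w + N) / V), lam, (zet + lam); split.
- by have := sqr_ge0 (ra + gam); lra.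
- by rewrite divr_gt0// mulr_gt0//; lra.
- by rewrite /V /w cE dE -raE -qE; ring.
- have -> : zet + lam - lam = zet by ring.
  have -> : zet ^+ 2 * a + lam ^+ 2 * b + (1 - lam) ^+ 2 * Q + lam ^+ 2 * N
      - 2 * zet * lam * c - 2 * lam * (1 - lam) * d =
    (zet * ra) ^+ 2 - 2 * (zet * ra) * (lam * gam) + lam ^+ 2 * (b + N)
      + (1 - lam) ^+ 2 * q ^+ 2 - 2 * lam * (1 - lam) * (del * q).
    by rewrite cE dE -raE -qE; ring.
  rewrite zetE.
  have -> : (lam * gam) ^+ 2 - 2 * (lam * gam) * (lam * gam) + lam ^+ 2 * (b + N)
      + (1 - lam) ^+ 2 * q ^+ 2 - 2 * lam * (1 - lam) * (del * q)
      = lam ^+ 2 * (w + N) + (lam * (del + q) - q) ^+ 2.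
    by rewrite /w; ring.
  have lE : lam * (del + q) - q = - (q * (w + N) / V).
    rewrite /lam; have : V != 0 by rewrite gt_eqF.
    by move=> V00; apply: (mulIf V00); rewrite mulrBl mulNr divfK// mulrAC divfK// /V; ring.
  rewrite lE /lam -qE.
  have -> : w + N = V - (q + del) ^+ 2 by rewrite /V; ring.
  by field; rewrite gt_eqF.
- have -> : ((ra + gam) ^+ 2 + V) * (Q * (w + N) / V) / (N * Q) =
      (1 + (ra + gam) ^+ 2 / V) * (1 + w / N) by field; rewrite !gt_eqF.
  rewrite /noise /V; apply: dpc_mono => //.
  + by rewrite w0 residE /w /P2d; lra.
  + rewrite sqr_ge0/= /corr -mulrA sq1 kD.
    have gr : ra <= Num.sqrt P1 by rewrite ler_wsqrtr.
    have gn := ler_norm gam; have gn' := ler_norm (- gam); rewrite normrN in gn'.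
    have := normr_ge0 gam; nra.
  + rewrite sqr_ge0/= -/sP uP -/q.
    have : (q - `|del|) ^+ 2 = q ^+ 2 - 2 * q * `|del| + del ^+ 2.
      by rewrite sqrrB real_normK ?num_real//; ring.
    move=> ->; rewrite sqrrD.
    have := ler_norm (- del); rewrite normrN; nra.
Qed.

End scalar.

(** * The rate bounds in the coordinates [k], [u], and the choice of a block length *)

Section region.
Variables (R : realType) (P1 P2 Q N : R).
Hypotheses (P10 : 0 <= P1) (P20 : 0 <= P2) (Q0 : 0 < Q) (N0 : 0 < N).

(** For [u] other than -1 the quotient (1 - rho_12^2 - rho_2s^2) / (1 - rho_2s^2) equals
    [1 - k ^+ 2], so [u] disappears from this bound. *)
Definition rate1 (k : R) : R := 2^-1 * ln (1 + P1 * (1 - k ^+ 2) / N).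

Definition rate2 (k u : R) : R :=
  2^-1 * ln (1 + corr P1 P2 k u / noise P2 Q N k u)
  + 2^-1 * ln (1 + resid P2 k u / N).

Lemma sqr_le1 (x : R) : -1 <= x <= 1 -> x ^+ 2 <= 1.
Proof. by move=> /andP[h1 h2]; nra. Qed.

Section in_square.
Variables k u : R.
Hypotheses (k01 : 0 <= k <= 1) (u01 : -1 <= u <= 0).

Let k2 : k ^+ 2 <= 1.
Proof. by apply: sqr_le1; case/andP: k01 => h1 h2; apply/andP; split; lra. Qed.

Let u2 : u ^+ 2 <= 1.
Proof. by apply: sqr_le1; case/andP: u01 => h1 h2; apply/andP; split; lra. Qed.

Lemma resid_ge0 : 0 <= resid P2 k u.
Proof. by rewrite /resid !mulr_ge0 ?subr_ge0. Qed.

Lemma noise_gt0 : 0 < noise P2 Q N k u.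
Proof.
by rewrite /noise ltr_wpDl// addr_ge0 ?sqr_ge0 ?resid_ge0.
Qed.

Lemma arg1_gt0 : 0 < 1 + P1 * (1 - k ^+ 2) / N.
Proof. by rewrite ltr_wpDr// divr_ge0 ?(ltW N0)// mulr_ge0 ?subr_ge0. Qed.

Lemma arg2_gt0 : 0 < 1 + corr P1 P2 k u / noise P2 Q N k u.
Proof. by rewrite ltr_wpDr// divr_ge0 ?(ltW noise_gt0)// sqr_ge0. Qed.

Lemma arg3_gt0 : 0 < 1 + resid P2 k u / N.
Proof. by rewrite ltr_wpDr// divr_ge0 ?(ltW N0)// resid_ge0. Qed.

Lemma rate2E : rate2 k u =
  2^-1 * ln ((1 + corr P1 P2 k u / noise P2 Q N k u) * (1 + resid P2 k u / N)).
Proof. by rewrite lnM ?posrE ?arg2_gt0 ?arg3_gt0// mulrDr. Qed.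

(* [rho_12 = k sqrt (1 - rho_2s^2)] makes the bounds continuous up to
   [rho_2s = -1]. *)
Lemma outer_bound_of_rates (p : R * R) :
  p.2 <= rate1 k -> p.1 + p.2 <= rate2 k u -> outer_bound P1 P2 Q N p.
Proof.
move=> h1 h2; pose r := k * Num.sqrt (1 - u ^+ 2).
have r2 : r ^+ 2 = k ^+ 2 * (1 - u ^+ 2) by rewrite exprMn sqr_sqrtr ?subr_ge0.
have rE : 1 - r ^+ 2 - u ^+ 2 = (1 - k ^+ 2) * (1 - u ^+ 2) by rewrite r2; ring.
have r0 : 0 <= r by rewrite mulr_ge0 ?sqrtr_ge0//; case/andP: k01.
have rsum : r ^+ 2 + u ^+ 2 <= 1.
  by rewrite -subr_ge0 opprD addrA rE mulr_ge0 ?subr_ge0.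
exists r, u; split=> //.
- rewrite r0 /= -(@ler_pXn2r _ 2) ?nnegrE// expr1n.
  by have := sqr_ge0 u; lra.
- apply: (le_trans h1); rewrite /rate1 ler_pM2l ?invr_gt0// ler_ln ?posrE ?arg1_gt0//.
    rewrite lerD2l ler_pM2r ?invr_gt0// ler_wpM2l// /ratio12.
    (* At [u = -1] the convention gives 1, which is at least the [1 - k ^+ 2] of [rate1]. *)
    case: eqP => [_|uN1]; first by have := sqr_ge0 k; lra.
    rewrite rE mulfK// subr_eq0 eq_sym; apply/eqP => /eqP.
    rewrite sqrf_eq1 => /orP[|] /eqP // u1.
    by case/andP: u01; rewrite u1 ler10.
  rewrite ltr_wpDr// divr_ge0 ?(ltW N0)// mulr_ge0// /ratio12.
  by case: eqP => // _; rewrite rE divr_ge0 ?mulr_ge0 ?subr_ge0.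
- by rewrite rE; exact: h2.
Qed.

End in_square.

(** A single long block suffices when slack [e] is allowed. The pair [k], [u] comes from that block
    and so depends on [e]. *)
Lemma achievable_relaxed (Rc R1 e : R) : 0 < e -> achievable P1 P2 Q N Rc R1 ->
  exists k u : R, [/\ 0 <= k <= 1, -1 <= u <= 0,
    R1 <= rate1 k + e & Rc + R1 <= rate2 k u + e].
Proof.
move=> e0 [Mc [M1 [C [Mpos [Mrate [Cok Cerr]]]]]].
pose er n : R := 1 - (\sum_w fine (prodp (gaussP n Q) (gaussP n N) (okset (C n) w)))
  / (Mc n * M1 n)%:R.
have erE n : err_prob Q N (C n) = (er n)%:E.
  by have [h1 h2] := Mpos n; apply: (err_probE (P1 := P1) (P2 := P2)) => //; exact: Cok.
have er0 : er n @[n --> \oo] --> (0 : R).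
  have -> : er = fun n => fine (err_prob Q N (C n)).
    by apply/funext => n; rewrite erE.
  exact: fine_cvg.
(* [B] bounds both rate expressions in absolute value, as rates may be negative here: half of [e]
   absorbs the error probability times the rate, the other half the 1/n. *)
pose B := `|R1| + `|Rc + R1| + 1; have B0 : 0 < B by rewrite ltr_wpDl ?addr_ge0.
have d0 : 0 < e / (2 * B) by rewrite divr_gt0// mulr_gt0.
have [n [n0 ern ninv]] : exists n, [/\ (0 < n)%N, `|er n| < e / (2 * B) &
    n%:R^-1 < e / 2].
  have [n1 _ h1] := (cvgrPdist_lt _ _).1 er0 _ d0.
  pose n2 := (Num.truncn (2 / e)).+1.
  exists (maxn n1 n2); split.
  - by rewrite leq_max orbT.
  - by have := h1 (maxn n1 n2) (leq_maxl _ _); rewrite sub0r normrN.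
  - rewrite -[ltRHS]invrK ltf_pV2 ?posrE ?invr_gt0 ?divr_gt0 ?ltr0n ?leq_max ?orbT//.
    rewrite invf_div; apply: (@lt_le_trans _ _ n2%:R).
      by rewrite truncnS_gt.
    by rewrite ler_nat leq_maxr.
have nr : 0 < n%:R :> R by rewrite ltr0n.
have [Mc0 M10] := Mpos n; have [hc h1] := Mrate n.
have Mc0r : 0 < (Mc n)%:R :> R by rewrite ltr0n.
have M10r : 0 < (M1 n)%:R :> R by rewrite ltr0n.
have [a [m [b [c [d [[m0 ma aP bP] H e1 I1 I2]]]]]] :=
  code_bounds Q0 N0 (Cok n) n0 Mc0 M10 (erE n).
have [k [u [k01 u01 km [sig [tau [lam [eta [sig0 tau0 sE tE G]]]]]]]] :=
  gaussian_optimum Q0 N0 m0 ma aP bP H.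
exists k, u.
have relax X F : `|X| <= B -> (1 - er n) * (n%:R * X) <= n%:R * F + 1 -> X <= F + e.
  move=> XB h.
  have h2 : (1 - er n) * X <= F + n%:R^-1.
    rewrite -(ler_pM2l nr) mulrDr divff ?gt_eqF// mulrCA.
    exact: h.
  have h3 : er n * X <= e / 2.
    apply: (le_trans (ler_norm _)); rewrite normrM.
    apply: (@le_trans _ _ (e / (2 * B) * B)).
      by apply: ler_pM => //; exact: ltW.
    by rewrite le_eqVlt; apply/orP; left; apply/eqP; field; rewrite gt_eqF.
  by lra.
have e1' : 0 <= 1 - er n by rewrite subr_ge0.
have L1 : n%:R * R1 <= ln (M1 n)%:R.
  by rewrite -(expRK (n%:R * R1)) ler_ln ?posrE ?expR_gt0.
have Lc : n%:R * Rc <= ln (Mc n)%:R.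
  by rewrite -(expRK (n%:R * Rc)) ler_ln ?posrE ?expR_gt0.
split=> //.
- apply: relax; first by rewrite /B -addrA lerDl addr_ge0.
  apply: (le_trans (ler_wpM2l e1' L1)); apply: (le_trans I1).
  rewrite lerD2r /rate1 mulrA ler_pM2l ?divr_gt0// ler_ln ?posrE ?arg1_gt0//.
    by rewrite lerD2l ler_pM2r ?invr_gt0.
  by rewrite ltr_wpDr// divr_ge0 ?(ltW N0)// subr_ge0.
- apply: relax; first by rewrite /B addrAC lerDr addr_ge0.
  have L : n%:R * (Rc + R1) <= ln (Mc n * M1 n)%:R.
    by rewrite natrM lnM ?posrE// mulrDr; exact: lerD.
  apply: (le_trans (ler_wpM2l e1' L)).
  apply: (le_trans (I2 sig tau lam eta sig0 tau0)).
  rewrite sE tE !divff ?gt_eqF// rate2E// lerD2r mulrA ler_pM2l ?divr_gt0//.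
  have -> : ln (sig * tau / (N * Q)) + 1 + 1 - 2 = ln (sig * tau / (N * Q)) by ring.
  rewrite ler_ln ?posrE ?mulr_gt0 ?arg2_gt0 ?arg3_gt0 ?invr_gt0//.
  by rewrite mulr_gt0.
Qed.

End region.

(** * Compactness of the parameter square *)

Section compactness.
Variables (R : realType) (P1 P2 Q N : R).
Hypotheses (P10 : 0 <= P1) (P20 : 0 <= P2) (Q0 : 0 < Q) (N0 : 0 < N).

Let Sq : set (R * R) := `[0, 1]%classic `*` `[-1, 0]%classic.

Lemma cvg_sqr (T : Type) (F : set_system T) (FF : Filter F) (f : T -> R) (l : R) :
  f x @[x --> F] --> l -> f x ^+ 2 @[x --> F] --> l ^+ 2.
Proof. by move=> fl; under eq_fun do rewrite expr2; rewrite expr2; exact: cvgM. Qed.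

Lemma cvg_lnat (T : Type) (F : set_system T) (FF : Filter F) (f : T -> R) (l : R) :
  0 < l -> f x @[x --> F] --> l -> ln (f x) @[x --> F] --> ln l.
Proof. by move=> l0 fl; apply: (cvg_comp _ _ fl); exact: continuous_ln. Qed.

Lemma rate1_continuous (x : R * R) : Sq x ->
  rate1 P1 N p.1 @[p --> x] --> rate1 P1 N x.1.
Proof.
case=> /=; rewrite !in_itv /= => k01 _.
have c1 : p.1 @[p --> x] --> x.1 by exact: cvg_fst.
rewrite /rate1; apply: cvgM; first exact: cvg_cst.
apply: cvg_lnat; first exact: arg1_gt0.
apply: cvgD; first exact: cvg_cst.
apply: cvgM; last exact: cvg_cst.
apply: cvgM; first exact: cvg_cst.
by apply: cvgB; [exact: cvg_cst|exact: cvg_sqr].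
Qed.

Lemma rate2_continuous (x : R * R) : Sq x ->
  rate2 P1 P2 Q N p.1 p.2 @[p --> x] --> rate2 P1 P2 Q N x.1 x.2.
Proof.
case=> /=; rewrite !in_itv /= => k01 u01.
have c1 : p.1 @[p --> x] --> x.1 by exact: cvg_fst.
have c2 : p.2 @[p --> x] --> x.2 by exact: cvg_snd.
have cu : 1 - p.2 ^+ 2 @[p --> x] --> 1 - x.2 ^+ 2.
  by apply: cvgB; [exact: cvg_cst|exact: cvg_sqr].
have cr : resid P2 p.1 p.2 @[p --> x] --> resid P2 x.1 x.2.
  apply: cvgM; first exact: cvg_cst.
  apply: cvgM => //.
  by apply: cvgB; [exact: cvg_cst|exact: cvg_sqr].
have ck : corr P1 P2 p.1 p.2 @[p --> x] --> corr P1 P2 x.1 x.2.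
  apply: cvg_sqr; apply: cvgD; first exact: cvg_cst.
  apply: cvgM; last exact: cvg_cst.
  apply: cvgM => //.
  by apply: (cvg_comp _ _ cu); exact: sqrt_continuous.
have cn : noise P2 Q N p.1 p.2 @[p --> x] --> noise P2 Q N x.1 x.2.
  apply: cvgD; last exact: cvg_cst.
  apply: cvgD => //; apply: cvg_sqr; apply: cvgD; first exact: cvg_cst.
  by apply: cvgM => //; exact: cvg_cst.
rewrite /rate2; apply: cvgD; (apply: cvgM; first exact: cvg_cst).
  apply: cvg_lnat; first exact: arg2_gt0.
  apply: cvgD; first exact: cvg_cst.
  apply: cvgM => //; apply: cvgV => //.
  by rewrite gt_eqF// noise_gt0.
apply: cvg_lnat; first exact: arg3_gt0.
apply: cvgD; first exact: cvg_cst.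
by apply: cvgM => //; exact: cvg_cst.
Qed.

(** The smaller of the two slacks is continuous on the compact square. Its maximum is at least [- e]
    for every positive [e], hence nonnegative, and the maximiser satisfies both bounds at once. *)
Lemma rates_attained (Rc R1 : R) :
  (forall e : R, 0 < e -> exists k u : R, [/\ 0 <= k <= 1, -1 <= u <= 0,
    R1 <= rate1 P1 N k + e & Rc + R1 <= rate2 P1 P2 Q N k u + e]) ->
  exists k u : R, [/\ 0 <= k <= 1, -1 <= u <= 0,
    R1 <= rate1 P1 N k & Rc + R1 <= rate2 P1 P2 Q N k u].
Proof.
move=> H.
pose f (p : R * R) : R :=
  Num.min (rate1 P1 N p.1 - R1) (rate2 P1 P2 Q N p.1 p.2 - (Rc + R1)).
have Sq0 : Sq !=set0 by exists (0, 0); split => /=; rewrite in_itv /= lexx ?ler01 ?lerN10.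
have cSq : compact Sq by apply: compact_setX; exact: segment_compact.
have cf : {within Sq, continuous f}.
  apply: continuous_in_subspaceT => x; rewrite inE => Sx.
  have c1 : rate1 P1 N p.1 - R1 @[p --> x] --> rate1 P1 N x.1 - R1.
    by apply: cvgB; [exact: rate1_continuous|exact: cvg_cst].
  have c2 : rate2 P1 P2 Q N p.1 p.2 - (Rc + R1) @[p --> x] -->
      rate2 P1 P2 Q N x.1 x.2 - (Rc + R1).
    by apply: cvgB; [exact: rate2_continuous|exact: cvg_cst].
  exact: (@cvg_comp _ _ _
    (fun p => (rate1 P1 N p.1 - R1, rate2 P1 P2 Q N p.1 p.2 - (Rc + R1)))
    (fun ab : R * R => Num.min ab.1 ab.2) _ _ _ (cvg_pair c1 c2)
    (@min_continuous _ R (_, _))).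
have [c cS cmax] := compact_EVT_max Sq0 cSq cf.
have f0 : 0 <= f c.
  apply/ler_addgt0Pr => e e0; have [k [u [k01 u01 h1 h2]]] := H e e0.
  have : f (k, u) <= f c by apply: cmax; rewrite inE; split; rewrite /= in_itv.
  have : - e <= f (k, u) by rewrite le_min; apply/andP; split => /=; lra.
  lra.
move: cS; rewrite inE => -[/=]; rewrite !in_itv /= => k01 u01.
move: f0; rewrite le_min !subr_ge0 => /andP[h1 h2].
by exists c.1, c.2.
Qed.

End compactness.

Theorem theorem4 (R : realType) (P1 P2 Q N : R) :
  0 <= P1 -> 0 <= P2 -> 0 < Q -> 0 < N ->
  capacity_region P1 P2 Q N `<=` outer_bound P1 P2 Q N.
Proof.
move=> P10 P20 Q0 N0 p pC.
have [k [u [k01 u01 h1 h2]]] : exists k u : R, [/\ 0 <= k <= 1, -1 <= u <= 0,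
    p.2 <= rate1 P1 N k & p.1 + p.2 <= rate2 P1 P2 Q N k u].
  apply: rates_attained => // e e0.
  (* An achievable point within [e / 3] in each coordinate costs up to 2 e / 3 in the sum; the
     relaxed bounds take the last third. *)
  have e3 : 0 < e / 3 by rewrite divr_gt0.
  have [p' [ap' [/= b1 b2]]] := pC _ (nbhsx_ballx p _ e3).
  have [k [u [k01 u01 h1 h2]]] := achievable_relaxed P10 P20 Q0 N0 e3 ap'.
  move: b1 b2; rewrite /ball /= => /ltr_normlW b1 /ltr_normlW b2.
  by exists k, u; split => //; lra.
by apply outer_bound_of_rates with (k := k) (u := u).
Qed.
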